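(* Let $n\ge 1$ be an integer and suppose $t>0$, $s>0$, and $1\le p<\infty$. Let $S_t$ and $T_t$ be the integral operators $$S_tf(z)=\int_{\mathbb{C}^n}e^{t\langle z,w\rangle}f(w)\,dv_t(w),\qquad T_tf(z)=\int_{\mathbb{C}^n}\left|e^{t\langle z,w\rangle}\right|f(w)\,dv_t(w).$$ Then the following conditions are equivalent: (a) $T_t$ is bounded on $L^p(\mathbb{C}^n,dv_s)$. (b) $S_t$ is bounded on $L^p(\mathbb{C}^n,dv_s)$. (c) $pt=2s$. Furthermore, whenever $pt=2s$, the operator norms of $S_t$ and $T_t$ on $L^p(\mathbb{C}^n,dv_s)$ satisfy $$\|S_t\|\le\|T_t\|=2^n.$$
   Context: For $z,w\in\mathbb{C}^n$, $\langle z,w\rangle=z_1\overline{w_1}+\cdots+z_n\overline{w_n}$ and $|z|=\sqrt{|z_1|^2+\cdots+|z_n|^2}$. For any $r>0$, $dv_r$ is the Gaussian probability measure $dv_r(z)=\left(\frac{r}{\pi}\right)^n e^{-r|z|^2}\,dv(z)$ on $\mathbb{C}^n$, where $dv$ is Lebesgue volume measure on $\mathbb{C}^n\cong\mathbb{R}^{2n}$. Functions are complex-valued. An integral operator is bounded on $L^p(\mathbb{C}^n,dv_s)$ if for every $f\in L^p(\mathbb{C}^n,dv_s)$ the defining integral converges absolutely for almost every $z$ and there is a constant $C$, independent of $f$, such that the $L^p(\mathbb{C}^n,dv_s)$ norm of the image of $f$ is at most $C$ times that of $f$; the operator norm is the least such $C$. Note that the measure in the definition of the operators is $dv_t$ while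 the $L^p$ space uses $dv_s$. *)

(* Defs.v *)
From HB Require Import structures.
From mathcomp Require Import all_boot all_order all_algebra.
From mathcomp Require Import all_classical all_reals all_analysis.
From mathcomp Require Import measurable_realfun.
From mathcomp Require Import complex.

Set Implicit Arguments.
Unset Strict Implicit.
Unset Printing Implicit Defensive.

Import Order.TTheory GRing.Theory Num.Theory.
Import numFieldNormedType.Exports.
Import ComplexField.Normc.

Local Open Scope classical_set_scope.
Local Open Scope ring_scope.
Local Open Scope complex_scope.

Definition complex_of_pair {R : Type} (xy : R * R) : R[i] := xy.1 +i* xy.2.

(* The Borel sets of R[i] are those of R * R, transported along the bijection
   complex_of_pair.  The space C^n is n.-tuple R[i] with the sigma-algebra that
   measurable_structure.v puts on tuples, i.e. the Borel sets of R^(2n). *)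
Section measurable_complex.
Context {R : realType}.

HB.instance Definition _ := isPointed.Build R[i] 0.

Definition measurable_complex : set (set R[i]) :=
  [set A | measurable (complex_of_pair @^-1` A)].

Let measurable_complex0 : measurable_complex set0.
Proof. exact: measurable0. Qed.

Let measurable_complexC A : measurable_complex A -> measurable_complex (~` A).
Proof. exact: measurableC. Qed.

Let measurable_complex_bigcup (F : (set R[i])^nat) :
  (forall i, measurable_complex (F i)) -> measurable_complex (\bigcup_i F i).
Proof.
move=> mF; rewrite /measurable_complex /= preimage_bigcup.
exact: bigcupT_measurable.
Qed.

HB.instance Definition _ := @isMeasurable.Build default_measure_display R[i]
  measurable_complex measurable_complex0 measurable_complexC
  measurable_complex_bigcup.

Lemma measurable_complex_of_pair :
  measurable_fun [set: R * R] (@complex_of_pair R).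
Proof. by move=> _ A mA; rewrite setTI. Qed.

Lemma measurable_Re : measurable_fun [set: R[i]] (@complex.Re R).
Proof.
move=> _ A mA; rewrite setTI -[X in measurable X]setTI.
exact: measurable_fst.
Qed.

Lemma measurable_Im : measurable_fun [set: R[i]] (@complex.Im R).
Proof.
move=> _ A mA; rewrite setTI -[X in measurable X]setTI.
exact: measurable_snd.
Qed.

End measurable_complex.

(* The library's canonical instance on \x only covers subprobabilities. *)
Lemma sigma_finite_product d1 d2 (T1 : measurableType d1)
    (T2 : measurableType d2) (R : realType)
    (m1 : {sigma_finite_measure set T1 -> \bar R})
    (m2 : {sigma_finite_measure set T2 -> \bar R}) :
  sigma_finite setT (m1 \x m2)%E.
Proof.
have /sigma_finiteP[F [TF ndF Foo]] := sigma_finiteT m1.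
have /sigma_finiteP[G [TG ndG Goo]] := sigma_finiteT m2.
exists (fun n => F n `*` G n).
  rewrite -setXTT TF TG predeqE => -[x y]; split.
    move=> [/= [n _ Fnx] [k _ Gky]]; exists (maxn n k) => //; split.
    - by move: x Fnx; exact/subsetPset/ndF/leq_maxl.
    - by move: y Gky; exact/subsetPset/ndG/leq_maxr.
  by move=> [n _ []/= ? ?]; split; exists n.
move=> k; have [? ?] := Foo k; have [? ?] := Goo k.
split; first exact: measurableX.
by rewrite product_measure1E// lte_mul_pinfty// ge0_fin_numE.
Qed.

Section lebesgue_complex.
Context {R : realType}.
Local Open Scope ereal_scope.

Definition lebesgue_complex : set R[i] -> \bar R :=
  pushforward ((@lebesgue_measure R) \x (@lebesgue_measure R)) complex_of_pair.

Let lebesgue_complex0 : lebesgue_complex set0 = 0.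
Proof. by rewrite /lebesgue_complex /pushforward preimage_set0 measure0. Qed.

Let lebesgue_complex_ge0 A : 0 <= lebesgue_complex A.
Proof. by rewrite /lebesgue_complex /pushforward measure_ge0. Qed.

Let lebesgue_complex_sigma_additive : semi_sigma_additive lebesgue_complex.
Proof.
move=> F mF tF mUF; rewrite /lebesgue_complex /pushforward preimage_bigcup.
apply: measure_semi_sigma_additive => //.
- apply/trivIsetP => /= i j _ _ ij; rewrite -preimage_setI.
  by move/trivIsetP : tF => /(_ _ _ _ _ ij) ->//; rewrite preimage_set0.
Qed.

HB.instance Definition _ := isMeasure.Build _ _ _ lebesgue_complex
  lebesgue_complex0 lebesgue_complex_ge0 lebesgue_complex_sigma_additive.

Let lebesgue_complex_sigma_finite : sigma_finite setT lebesgue_complex.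
Proof.
have [F UF mF] :=
  sigma_finite_product (@lebesgue_measure R) (@lebesgue_measure R).
have FE i : complex_of_pair @^-1`
    ((fun z : R[i] => (complex.Re z, complex.Im z)) @^-1` F i) = F i.
  by apply/seteqP; split => -[].
exists (fun i => (fun z : R[i] => (complex.Re z, complex.Im z)) @^-1` F i).
  by rewrite -preimage_bigcup -UF.
move=> i; rewrite /lebesgue_complex /pushforward FE.
by have [mFi Fioo] := mF i; split=> //; rewrite /measurable/= /measurable_complex/= FE.
Qed.

HB.instance Definition _ := Measure_isSigmaFinite.Build _ _ _
  lebesgue_complex lebesgue_complex_sigma_finite.

End lebesgue_complex.

Section lebesgue_cons.
Context {R : realType} (n : nat).
Variable mu : {sigma_finite_measure set (n.-tuple R[i]) -> \bar R}.
Local Open Scope ereal_scope.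

Definition cons_pair (zv : R[i] * n.-tuple R[i]) : n.+1.-tuple R[i] :=
  [tuple of zv.1 :: zv.2].

Definition uncons_pair (z : n.+1.-tuple R[i]) : R[i] * n.-tuple R[i] :=
  (thead z, [tuple of behead z]).

Lemma cons_pairK : cancel cons_pair uncons_pair.
Proof.
by case=> z v; congr pair; rewrite /= ?theadE//; apply/val_inj.
Qed.

Lemma measurable_cons_pair : measurable_fun setT cons_pair.
Proof. exact: measurable_cons. Qed.

Lemma measurable_uncons_pair : measurable_fun setT uncons_pair.
Proof.
apply: measurable_fun_pair; first exact: measurable_tnth.
exact: measurable_behead.
Qed.

Definition lebesgue_cons : set (n.+1.-tuple R[i]) -> \bar R :=
  pushforward (@lebesgue_complex R \x mu) cons_pair.

Let measurable_preimage A : measurable A -> measurable (cons_pair @^-1` A).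
Proof.
by move=> mA; rewrite -[X in measurable X]setTI; exact: measurable_cons_pair.
Qed.

Let lebesgue_cons0 : lebesgue_cons set0 = 0.
Proof. by rewrite /lebesgue_cons /pushforward preimage_set0 measure0. Qed.

Let lebesgue_cons_ge0 A : 0 <= lebesgue_cons A.
Proof. by rewrite /lebesgue_cons /pushforward measure_ge0. Qed.

Let lebesgue_cons_sigma_additive : semi_sigma_additive lebesgue_cons.
Proof.
move=> F mF tF mUF; rewrite /lebesgue_cons /pushforward preimage_bigcup.
apply: measure_semi_sigma_additive.
- by move=> i; exact: measurable_preimage.
- apply/trivIsetP => /= i j _ _ ij; rewrite -preimage_setI.
  by move/trivIsetP : tF => /(_ _ _ _ _ ij) ->//; rewrite preimage_set0.
- by rewrite -preimage_bigcup; exact: measurable_preimage.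
Qed.

HB.instance Definition _ := isMeasure.Build _ _ _ lebesgue_cons
  lebesgue_cons0 lebesgue_cons_ge0 lebesgue_cons_sigma_additive.

Let lebesgue_cons_sigma_finite : sigma_finite setT lebesgue_cons.
Proof.
have [F UF mF] := sigma_finite_product (@lebesgue_complex R) mu.
have FE i : cons_pair @^-1` (uncons_pair @^-1` F i) = F i.
  by apply/seteqP; split => zv /=; rewrite cons_pairK.
exists (fun i => uncons_pair @^-1` F i).
  by rewrite -preimage_bigcup -UF.
move=> i; rewrite /lebesgue_cons /pushforward FE; have [mFi Fioo] := mF i.
split => //; rewrite -[X in measurable X]setTI.
exact: measurable_uncons_pair.
Qed.

HB.instance Definition _ := Measure_isSigmaFinite.Build _ _ _
  lebesgue_cons lebesgue_cons_sigma_finite.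

End lebesgue_cons.

(* Lebesgue volume measure dv on C^n: the n-fold product of Lebesgue measure
   on C; see volumeE for its value on boxes. *)
Fixpoint volume {R : realType} (n : nat) :
    {sigma_finite_measure set (n.-tuple R[i]) -> \bar R} :=
  match n with
  | 0 => \d_[tuple]
  | m.+1 => lebesgue_cons (volume m)
  end.

Lemma volumeE {R : realType} (n : nat) (A : 'I_n -> set R[i]) :
  (forall i, measurable (A i)) ->
  volume n [set z : n.-tuple R[i] | forall i, A i (tnth z i)] =
  (\prod_(i < n) lebesgue_complex (A i))%E.
Proof.
elim: n A => [|n ih] A mA.
  by rewrite big_ord0 /= diracE mem_set// => -[].
rewrite big_ord_recl -ih// /= /lebesgue_cons /pushforward.
rewrite -product_measure1E//; last first.
  rewrite [X in measurable X](_ : _ = \bigcap_(i in [set` finset.setT])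
      (@tnth n R[i] ^~ i @^-1` A (lift ord0 i))).
    apply: fin_bigcap_measurable => // i _; rewrite -[X in measurable X]setTI.
    exact: measurable_tnth.
  apply/seteqP; split => [z zA i _|z zA i]; first exact: zA.
  by apply: zA; rewrite /= finset.in_setT.
congr (_ \x _)%E; apply/seteqP; split => [[z v] /= zvA|[z v] /= [zA vA] i].
  split; first by have := zvA ord0; rewrite tnth0.
  by move=> i; have := zvA (lift ord0 i); rewrite tnthS.
by case: (unliftP ord0 i) => [j|] ->; rewrite ?tnthS// tnth0.
Qed.

Definition inner {R : realType} {n : nat} (z w : n.-tuple R[i]) : R[i] :=
  \sum_(i < n) tnth z i * (tnth w i)^*.

Definition enorm {R : realType} {n : nat} (z : n.-tuple R[i]) : R :=
  Num.sqrt (\sum_(i < n) normc (tnth z i) ^+ 2).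

Section gaussian.
Context {R : realType} (n : nat) (r : {posnum R}).

Definition gaussian_density (z : n.-tuple R[i]) : R :=
  (r%:num / pi) ^+ n * expR (- (r%:num * enorm z ^+ 2)).

Definition gaussian (A : set (n.-tuple R[i])) : \bar R :=
  (\int[volume n]_(z in A) (gaussian_density z)%:E)%E.

Lemma gaussian_density_ge0 z : 0 <= gaussian_density z.
Proof. by rewrite mulr_ge0 ?expR_ge0// exprn_ge0// divr_ge0// pi_ge0. Qed.

Let measurable_sqrt : measurable_fun [set: R] (@Num.sqrt R).
Proof. apply: continuous_measurable_fun; exact: sqrt_continuous. Qed.

Lemma measurable_gaussian_density : measurable_fun setT gaussian_density.
Proof.
apply: measurable_funM => //; apply: measurableT_comp => //.
apply: measurableT_comp => //; apply: measurable_funM => //.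
apply: measurable_funX.
rewrite /enorm; apply: (measurableT_comp measurable_sqrt).
apply: measurable_sum => i; apply: measurable_funX.
rewrite (_ : (fun _ => _) = (fun z : n.-tuple R[i] => Num.sqrt
  (complex.Re (tnth z i) ^+ 2 + complex.Im (tnth z i) ^+ 2))); last first.
  by apply/funext => z; case: (tnth z i).
apply: (measurableT_comp measurable_sqrt).
apply: measurable_funD; apply: measurable_funX.
  exact: (measurableT_comp measurable_Re (measurable_tnth i)).
exact: (measurableT_comp measurable_Im (measurable_tnth i)).
Qed.

Let gaussian0 : gaussian set0 = 0%E.
Proof. exact: integral_set0. Qed.

Let gaussian_ge0 A : (0 <= gaussian A)%E.
Proof. by apply: integral_ge0 => z _; rewrite lee_fin gaussian_density_ge0. Qed.

Let gaussian_sigma_additive : semi_sigma_additive gaussian.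
Proof.
apply: semi_sigma_additive_nng_induced.
  by apply/measurable_EFinP; exact: measurable_gaussian_density.
by move=> z; rewrite lee_fin gaussian_density_ge0.
Qed.

HB.instance Definition _ := isMeasure.Build _ _ _ gaussian
  gaussian0 gaussian_ge0 gaussian_sigma_additive.

End gaussian.
Arguments gaussian {R} n r A.

Definition cexp {R : realType} (z : R[i]) : R[i] :=
  (expR (complex.Re z))%:C * (cos (complex.Im z) +i* sin (complex.Im z)).

Section complex_Lp.
Context d {X : measurableType d} {R : realType}.
Variable mu : {measure set X -> \bar R}.

Definition cintegrable (F : X -> R[i]) : Prop :=
  measurable_fun setT F /\ (\int[mu]_x (normc (F x))%:E < +oo)%E.

Definition cintegral (F : X -> R[i]) : R[i] :=
  (\int[mu]_x complex.Re (F x)) +i* (\int[mu]_x complex.Im (F x)).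

Definition cLnorm (p : R) (f : X -> R[i]) : \bar R :=
  Lnorm mu p%:E (fun x => (normc (f x))%:E).

Definition in_Lp (p : R) (f : X -> R[i]) : Prop :=
  measurable_fun setT f /\ (cLnorm p f < +oo)%E.

End complex_Lp.

Section integral_operator.
Context d {X : measurableType d} {R : realType}.
(* nu : the measure in the integral operator; mu : the measure of L^p *)
Variables (nu : {measure set X -> \bar R}) (k : X -> X -> R[i]).
Variables (mu : {measure set X -> \bar R}) (p : R).

(* The value is only meaningful at those z for which w |-> k z w * f w is
   nu-integrable. *)
Definition intop (f : X -> R[i]) : X -> R[i] :=
  fun z => cintegral nu (fun w => k z w * f w).

Definition intop_bound (C : R) : Prop :=
  forall f, in_Lp mu p f -> (cLnorm mu p (intop f) <= C%:E * cLnorm mu p f)%E.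

(* No measurability condition on intop f is needed here: it is automatic when
   f and k are measurable (k jointly) and nu is sigma-finite. *)
Definition intop_bounded : Prop :=
  (forall f, in_Lp mu p f ->
    {ae mu, forall z, cintegrable nu (fun w => k z w * f w)}) /\
  exists C : R, intop_bound C.

(* The admissible C form a closed set, so this infimum is the least of them
   when the operator is bounded; it is +oo when there is none. *)
Definition intop_norm : \bar R := ereal_inf [set C%:E | C in intop_bound].

End integral_operator.

Definition S_kernel {R : realType} {n : nat} (t : {posnum R})
    (z w : n.-tuple R[i]) : R[i] :=
  cexp ((t%:num)%:C * inner z w).

Definition T_kernel {R : realType} {n : nat} (t : {posnum R})
    (z w : n.-tuple R[i]) : R[i] :=
  `|S_kernel t z w|.

(* Main.v *)
Require Import Defs.
From HB Require Import structures.
From mathcomp Require Import all_boot all_order all_algebra.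
From mathcomp Require Import all_classical all_reals all_analysis.
From mathcomp Require Import measurable_realfun.
From mathcomp Require Import complex.
From mathcomp Require Import ring lra.

Set Implicit Arguments.
Unset Strict Implicit.
Unset Printing Implicit Defensive.

Import Order.TTheory GRing.Theory Num.Theory.
Import numFieldNormedType.Exports.
Import ComplexField.Normc.

Local Open Scope ring_scope.
Local Open Scope classical_set_scope.

(** Write a = t / 2. The weight exp (- s |z|^2) of L^p(dv_s) is the p-th power
    of exp (- a |z|^2) exactly when p t = 2 s. In that case f |-> f exp (- a
    |.|^2) carries L^p(dv_s) isometrically (up to a constant) onto L^p(dv),
    and since 2 Re <z, w> = |z|^2 + |w|^2 - |z - w|^2, it carries T to the
    convolution with (t / pi)^n exp (- a |z|^2), a function of total mass 2^n
    ([integral_gauss_kernel]). Hence the norm of T is at most 2^n, by Schur's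
    test ([schur_test], [cLnorm_intop_le]), and the bound passes to S because
    |S f| <= T |f|. Wide Gaussians are nearly fixed, up to the factor 2^n, by
    that convolution: testing on exp ((a - e) |z|^2) with e tending to 0 shows
    that 2^n is attained in the limit ([Re_T_gauss_test], [T_bound_ge2n]).

    Conversely, assume one of the operators bounded, and let l > 0. Test it on
    the indicator of a cube of side about 1 / j at the point j e_1, and look
    at the image on the cube of the same size at l j e_1. There the phase t Im
    <z, w> is at most 1 in absolute value, so that S does not benefit from
    cancellation, and both kernels have real part at least cos 1 exp (t l
    j^2). Comparing norms bounds exp (j^2 (p t (l - 1) - s (l^2 - 1))) by a
    constant times a power of j, so p t (l - 1) <= s (l^2 - 1) for all l > 0:
    the line is below the parabola and meets it at l = 1, so their slopes p t
    and 2 s there agree. The choice l = p t / (2 s) gives this at once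
    ([box_test], [bound_exponents]). *)

(** * Complex numbers *)

Lemma normc_ge0 {R : realType} (z : R[i]) : 0 <= normc z.
Proof. by case: z => a b; exact: sqrtr_ge0. Qed.

Lemma ler_norm_Re {R : realType} (z : R[i]) : `|complex.Re z| <= normc z.
Proof. by case: z => a b /=; rewrite -sqrtr_sqr ler_wsqrtr// lerDl sqr_ge0. Qed.

Lemma ler_norm_Im {R : realType} (z : R[i]) : `|complex.Im z| <= normc z.
Proof. by case: z => a b /=; rewrite -sqrtr_sqr ler_wsqrtr// lerDr sqr_ge0. Qed.

Lemma Re_le_normc {R : realType} (z : R[i]) : complex.Re z <= normc z.
Proof. exact: le_trans (ler_norm _) (ler_norm_Re z). Qed.

Lemma normc_real {R : realType} (x : R) : 0 <= x -> normc (x%:C%C) = x.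
Proof. by move=> x0; rewrite /= expr0n/= addr0 sqrtr_sqr ger0_norm. Qed.

Lemma Re_scaled {R : realType} (c : R) (x : R[i]) :
  complex.Re (c%:C * x)%C = c * complex.Re x.
Proof. by case: x => a b /=; rewrite mul0r subr0. Qed.

Lemma Im_scaled {R : realType} (c : R) (x : R[i]) :
  complex.Im (c%:C * x)%C = c * complex.Im x.
Proof. by case: x => a b /=; rewrite mul0r addr0. Qed.

Lemma measurable_sqrt {R : realType} : measurable_fun [set: R] (@Num.sqrt R).
Proof. by apply: continuous_measurable_fun; exact: sqrt_continuous. Qed.

Lemma measurable_normc {R : realType} : measurable_fun [set: R[i]] (@normc R).
Proof.
rewrite (_ : @normc R = fun z : R[i] =>
  Num.sqrt (complex.Re z ^+ 2 + complex.Im z ^+ 2)); last first.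
  by apply/funext => -[].
apply: (measurableT_comp measurable_sqrt).
by apply: measurable_funD; apply: measurable_funX;
  [exact: measurable_Re|exact: measurable_Im].
Qed.

Section measurable_complex_functions.
Context d {X : measurableType d} {R : realType}.

Lemma measurable_complex_pair (f : X -> R[i]) :
  measurable_fun setT (fun x => complex.Re (f x)) ->
  measurable_fun setT (fun x => complex.Im (f x)) -> measurable_fun setT f.
Proof.
move=> mRe mIm.
rewrite (_ : f =
  complex_of_pair \o (fun x => (complex.Re (f x), complex.Im (f x)))).
  apply: measurableT_comp; first exact: measurable_complex_of_pair.
  exact: measurable_fun_pair.
by apply/funext => x /=; rewrite /complex_of_pair; case: (f x).
Qed.

Lemma measurable_complexM (f g : X -> R[i]) :
  measurable_fun setT f -> measurable_fun setT g ->
  measurable_fun setT (fun x => f x * g x).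
Proof.
move=> mf mg.
have mRf : measurable_fun setT (fun x => complex.Re (f x)).
  exact: measurableT_comp measurable_Re mf.
have mIf : measurable_fun setT (fun x => complex.Im (f x)).
  exact: measurableT_comp measurable_Im mf.
have mRg : measurable_fun setT (fun x => complex.Re (g x)).
  exact: measurableT_comp measurable_Re mg.
have mIg : measurable_fun setT (fun x => complex.Im (g x)).
  exact: measurableT_comp measurable_Im mg.
apply: measurable_complex_pair.
  rewrite (_ : (fun _ => _) = (fun x => complex.Re (f x) * complex.Re (g x)
    - complex.Im (f x) * complex.Im (g x))).
    by apply: measurable_funB; exact: measurable_funM.
  by apply/funext => x; case: (f x) => a b; case: (g x).
rewrite (_ : (fun _ => _) = (fun x => complex.Re (f x) * complex.Im (g x)
    + complex.Im (f x) * complex.Re (g x))).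
  by apply: measurable_funD; exact: measurable_funM.
by apply/funext => x; case: (f x) => a b; case: (g x).
Qed.

End measurable_complex_functions.

(** * Integrals and norms *)

Lemma measurable_fun_powR d (X : measurableType d) (R : realType) (f : X -> R)
    (p : R) :
  measurable_fun setT f -> measurable_fun setT (fun x => f x `^ p).
Proof. exact: (@measurableT_comp _ _ _ _ _ _ (@powR R ^~ p)). Qed.

Section measure_lemmas.
Context d {X : measurableType d} {R : realType}.
Variable mu : {measure set X -> \bar R}.
Local Open Scope ereal_scope.

(** Immediate from the definition of the integral as a supremum.  Images under
    an integral operator are compared through this lemma, which saves proving
    that they are measurable. *)
Lemma le_integral_nonmeasurable (f g : X -> \bar R) :
  (forall x, 0 <= f x) -> (forall x, f x <= g x) ->
  \int[mu]_x f x <= \int[mu]_x g x.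
Proof.
move=> f0 fg; have g0 x : 0 <= g x by exact: le_trans (fg x).
rewrite !ge0_integralTE//; apply: ereal_sup_le => _ [h hf <-].
by exists h => // x; exact: le_trans (fg x).
Qed.

Import HBNNSimple.

(** Both sides commute with increasing limits, so simple functions suffice; for
    an indicator the equality is the hypothesis on [nu]. *)
Lemma integral_density (nu : {measure set X -> \bar R}) (h : X -> R)
    (f : X -> \bar R) :
  measurable_fun setT h -> (forall x, (0 <= h x)%R) ->
  (forall A, measurable A -> nu A = \int[mu]_(x in A) (h x)%:E) ->
  measurable_fun setT f -> (forall x, 0 <= f x) ->
  \int[nu]_x f x = \int[mu]_x (f x * (h x)%:E).
Proof.
move=> mh h0 nuE mf f0.
have {}mh : measurable_fun setT (EFin \o h) by exact/measurable_EFinP.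
pose g := nnsfun_approx measurableT mf.
have gf x : (g n x)%:E @[n --> \oo] --> f x by exact: cvg_nnsfun_approx.
have ndg x m n : (m <= n)%N -> (g m x <= g n x)%R.
  by move=> mn; exact/lefP/nd_nnsfun_approx.
transitivity (limn (fun n => \int[nu]_x (g n x)%:E)).
  rewrite -monotone_convergence//.
  - by apply: eq_integral => x _; apply/esym/cvg_lim => //.
  - by move=> n; exact/measurable_EFinP/measurable_funP.
  - by move=> n y _; rewrite lee_fin.
  - by move=> y _ m n mn; rewrite lee_fin ndg.
rewrite [X in limn X](_ : _ = (fun n => \int[mu]_x ((g n x)%:E * (h x)%:E))).
  rewrite -monotone_convergence//.
  - apply: eq_integral => x _; apply/cvg_lim => //.
    exact: cvgeZr.
  - move=> n; apply: emeasurable_funM => //.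
    exact/measurable_EFinP/measurable_funP.
  - by move=> n y _; rewrite mule_ge0 ?lee_fin//.
  - by move=> y _ m n mn; rewrite lee_wpmul2r ?lee_fin ?ndg//.
apply/funext => n.
transitivity (\sum_(k \in range (g n))
    \int[nu]_x (k * \1_(g n @^-1` [set k]) x)%:E).
  under eq_integral do rewrite fimfunE -fsumEFin//.
  rewrite ge0_integral_fsum//.
  - by move=> y; exact/measurable_EFinP/measurable_funM.
  - by move=> y x _; rewrite nnfun_muleindic_ge0.
transitivity (\sum_(k \in range (g n))
    \int[mu]_x ((k * \1_(g n @^-1` [set k]) x)%:E * (h x)%:E)).
  apply: eq_fsbigr => r _.
  rewrite integralZl_indic_nnsfun// integral_indic//= setIT nuE//.
  rewrite [in LHS]integral_mkcond.
  have [r0|r0] := leP 0%R r.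
    rewrite -ge0_integralZl//.
    - apply: eq_integral => x _; rewrite EFinM -muleA; congr (_ * _).
      by rewrite epatch_indic muleC.
    - by apply/(measurable_restrictT _ _).1 => //; exact: measurable_funTS.
    - by move=> x _; apply: erestrict_ge0 => y _; rewrite lee_fin.
  rewrite preimage_nnfun0//= patch_set0 integral0 mule0 integral0_eq// => x _.
  by rewrite indic0 mulr0 mul0e.
rewrite -ge0_integral_fsum//.
- apply: eq_integral => x _; rewrite -ge0_mule_fsuml; last first.
    by move=> k; rewrite EFinM nnfun_muleindic_ge0.
  by rewrite fsumEFin// -fimfunE.
- move=> r; apply: emeasurable_funM => //.
  exact/measurable_EFinP/measurable_funM.
- move=> r x _; apply: mule_ge0; last by rewrite lee_fin.
  by rewrite EFinM nnfun_muleindic_ge0.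
Qed.

(** If I = a + ib is the integral of F, then |I|^2 = a^2 + b^2 is the integral
    of a Re F + b Im F, which is at most |I| |F|; divide by |I|. *)
Lemma normc_cintegral_le (F : X -> R[i]) :
  measurable_fun setT F ->
  (normc (cintegral mu F))%:E <= \int[mu]_x (normc (F x))%:E.
Proof.
move=> mF.
have [Foo|] := ltP (\int[mu]_x (normc (F x))%:E) +oo; last first.
  by rewrite leye_eq => /eqP ->; rewrite leey.
have mRe : measurable_fun setT (@complex.Re R \o F).
  exact: measurableT_comp measurable_Re _.
have mIm : measurable_fun setT (@complex.Im R \o F).
  exact: measurableT_comp measurable_Im _.
have mN : measurable_fun setT (fun x => normc (F x)).
  exact: measurableT_comp measurable_normc mF.
have iN : mu.-integrable setT (EFin \o (fun x => normc (F x))).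
  apply/integrableP; split; first exact/measurable_EFinP.
  by under eq_integral do rewrite /= ger0_norm ?normc_ge0//.
have iRe : mu.-integrable setT (EFin \o (@complex.Re R \o F)).
  apply: le_integrable iN => //; first exact/measurable_EFinP.
  by move=> x _ /=; rewrite lee_fin [leRHS]ger0_norm ?normc_ge0// ler_norm_Re.
have iIm : mu.-integrable setT (EFin \o (@complex.Im R \o F)).
  apply: le_integrable iN => //; first exact/measurable_EFinP.
  by move=> x _ /=; rewrite lee_fin [leRHS]ger0_norm ?normc_ge0// ler_norm_Im.
have I0 : 0 <= \int[mu]_x (normc (F x))%:E.
  by apply: integral_ge0 => x _; rewrite lee_fin normc_ge0.
rewrite -[leRHS]fineK; last by rewrite ge0_fin_numE.
rewrite lee_fin /cintegral.
set a := Rintegral mu _ (fun x => complex.Re (F x)).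
set b := Rintegral mu _ (fun x => complex.Im (F x)).
set I := fine _.
pose N := Num.sqrt (a ^+ 2 + b ^+ 2)%R.
rewrite -[normc _]/N.
have NE : (N ^+ 2 = a ^+ 2 + b ^+ 2)%R.
  by rewrite sqr_sqrtr// addr_ge0// sqr_ge0.
have N0 : (0 <= N)%R by exact: sqrtr_ge0.
suff : (N ^+ 2 <= N * I)%R.
  have := N0; rewrite le_eqVlt => /predU1P[<- _|Ngt0]; first exact: fine_ge0.
  by rewrite expr2 ler_pM2l.
rewrite NE.
have -> : (a ^+ 2 + b ^+ 2 =
    \int[mu]_x (a * complex.Re (F x) + b * complex.Im (F x)))%R.
  rewrite RintegralD//.
  - by rewrite !RintegralZl.
  - exact: (integrableZl measurableT a iRe).
  - exact: (integrableZl measurableT b iIm).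
rewrite -[(N * I)%R]RintegralZl//.
apply: le_Rintegral => //.
- apply: (integrableD _ (f := fun x => (a * complex.Re (F x))%:E)
    (g := fun x => (b * complex.Im (F x))%:E)) => //.
  + exact: (integrableZl measurableT a iRe).
  + exact: (integrableZl measurableT b iIm).
- exact: (integrableZl measurableT N iN).
- move=> x _; apply: le_trans (ler_norm _) _.
  (* Cauchy-Schwarz in the plane, by Lagrange's identity *)
  rewrite -[leLHS]sqrtr_sqr /N.
  case: (F x) => u v /=; rewrite -sqrtrM ?addr_ge0 ?sqr_ge0// ler_wsqrtr//.
  rewrite -subr_ge0 (_ : (_ - _)%R = (a * v - b * u) ^+ 2)%R ?sqr_ge0//.
  by ring.
Qed.

End measure_lemmas.

Section Lnorm_lemmas.
Context d {X : measurableType d} {R : realType}.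
Variables (mu : {measure set X -> \bar R}) (p : R).
Hypothesis p0 : 0 < p.
Local Open Scope ereal_scope.

Lemma le_Lnorm_nonmeasurable (f g : X -> \bar R) :
  (forall x, `|f x| <= `|g x|) -> Lnorm mu p%:E f <= Lnorm mu p%:E g.
Proof.
move=> fg; rewrite unlock; apply: gt0_ler_poweR.
- by rewrite invr_ge0 ltW.
- by rewrite in_itv/= leey andbT; apply: integral_ge0 => x _; exact: poweR_ge0.
- by rewrite in_itv/= leey andbT; apply: integral_ge0 => x _; exact: poweR_ge0.
apply: le_integral_nonmeasurable => x; first exact: poweR_ge0.
by apply: gt0_ler_poweR; rewrite ?in_itv/= ?leey ?andbT// ltW.
Qed.

Lemma mul_LnormE (c : R) (f : X -> \bar R) : (0 <= c)%R ->
  c%:E * Lnorm mu p%:E f =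
  ((c `^ p)%:E * \int[mu]_x (`|f x| `^ p)) `^ p^-1.
Proof.
move=> c0; rewrite unlock poweRM ?lee_fin ?powR_ge0//; last first.
  by apply: integral_ge0 => x _; exact: poweR_ge0.
by rewrite poweR_EFin -powRrM mulfV ?gt_eqF// powRr1.
Qed.

Lemma le_scaled_Lnorm (c : R) (f g : X -> \bar R) : (0 <= c)%R ->
  \int[mu]_x (`|f x| `^ p) <= (c `^ p)%:E * \int[mu]_x (`|g x| `^ p) ->
  Lnorm mu p%:E f <= c%:E * Lnorm mu p%:E g.
Proof.
move=> c0 fg; have I0 h : 0 <= \int[mu]_x (`|h x| `^ p).
  by apply: integral_ge0 => x _; exact: poweR_ge0.
rewrite mul_LnormE// [in leLHS]unlock; apply: gt0_ler_poweR => //.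
- by rewrite invr_ge0 ltW.
- by rewrite in_itv/= leey andbT.
- by rewrite in_itv/= leey andbT mule_ge0// lee_fin powR_ge0.
Qed.

End Lnorm_lemmas.

Lemma mul_Lnorm_EFin d (X : measurableType d) (R : realType)
    (mu : {measure set X -> \bar R}) (p c : R) (f : X -> R) :
  0 < p -> 0 <= c -> measurable_fun setT f ->
  (c%:E * Lnorm mu p%:E (fun x => (f x)%:E) =
   Lnorm mu p%:E (fun x => (c * f x)%:E))%E.
Proof.
move=> p0 c0 mf; rewrite mul_LnormE// unlock; congr poweR.
rewrite -ge0_integralZl_EFin ?powR_ge0//.
- apply: eq_integral => x _; rewrite !abse_EFin !poweR_EFin -EFinM.
  by rewrite normrM (ger0_norm c0) powRM.
- by move=> x _; exact: poweR_ge0.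
- apply: (measurableT_comp (measurable_poweR p)).
  by apply/measurable_EFinP; exact: measurableT_comp.
Qed.

(** * Schur's test *)

Section schur.
Context d {X : measurableType d} {R : realType}.
Local Open Scope ereal_scope.

(** Hoelder's inequality for k g = k^(1/q) (k^(1/p) g), with p, q conjugate:
    Jensen's inequality for a measure k mu of mass at most [M]. *)
Lemma integral_powR_le (mu : {measure set X -> \bar R}) (k g : X -> R)
    (M p : R) : (1 <= p)%R ->
  measurable_fun setT k -> (forall w, (0 <= k w)%R) ->
  measurable_fun setT g -> (forall w, (0 <= g w)%R) ->
  \int[mu]_w (k w)%:E <= M%:E ->
  (\int[mu]_w (k w * g w)%:E) `^ p <=
    (M `^ (p - 1))%:E * \int[mu]_w (k w * g w `^ p)%:E.
Proof.
move=> p1 mk k0 mg g0 kM.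
have intk0 : 0 <= \int[mu]_w (k w)%:E.
  by apply: integral_ge0 => w _; rewrite lee_fin.
have [->|pN1] := eqVneq p 1%R.
  rewrite subrr powRr0 mul1e poweRe1; last first.
    by apply: integral_ge0 => w _; rewrite lee_fin mulr_ge0.
  by under [leRHS]eq_integral do rewrite powRr1//.
have {p1 pN1}p1 : (1 < p)%R by rewrite lt_neqAle eq_sym pN1.
have p0 : (0 < p)%R by lra.
have pN0 : (p != 0)%R by rewrite gt_eqF.
pose q := (p / (p - 1))%R.
have q0 : (0 < q)%R by rewrite divr_gt0// subr_gt0.
have qN0 : (q != 0)%R by rewrite gt_eqF.
have pq : (q^-1 + p^-1 = 1)%R.
  by rewrite /q; field; rewrite pN0 /= subr_eq0 gt_eqF.
have powK (r x : R) : (r != 0 -> 0 <= x -> (x `^ r^-1) `^ r = x)%R.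
  by move=> r0 x0; rewrite -powRrM mulVf// powRr1.
have mpow (r : R) (f : X -> R) : measurable_fun setT f ->
    measurable_fun setT (fun w => (f w `^ r)%R).
  by move=> mf; exact: measurable_fun_powR.
have := @hoelder _ _ _ mu (fun w => (k w `^ q^-1)%R)
  (fun w => (k w `^ p^-1 * g w)%R) q p (mpow _ _ mk)
  (measurable_funM (mpow _ _ mk) mg) q0 p0 pq.
rewrite Lnorm1.
have -> : \int[mu]_x `|((k x `^ q^-1) * (k x `^ p^-1 * g x))%:E| =
    \int[mu]_w (k w * g w)%:E.
  apply: eq_integral => w _; rewrite gee0_abs; last first.
    by rewrite lee_fin !mulr_ge0// powR_ge0.
  rewrite mulrA -powRD; last by rewrite pq oner_eq0.
  by rewrite pq powRr1.
move=> hoeld.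
apply: (@le_trans _ _ _ _ _ (gt0_ler_poweR (ltW p0) _ _ hoeld)).
- by rewrite in_itv/= leey andbT integral_ge0// => w _; rewrite lee_fin mulr_ge0.
- by rewrite in_itv/= leey andbT mule_ge0// Lnorm_ge0.
rewrite poweRM ?Lnorm_ge0// poweR_Lnorm//.
apply: lee_pmul; rewrite ?poweR_ge0//.
- by apply: integral_ge0 => w _; exact: poweR_ge0.
- have qp : (p = q * (p - 1))%R.
    by rewrite /q; field; rewrite subr_eq0 gt_eqF.
  rewrite [in X in _ `^ X]qp poweRrM poweR_Lnorm//.
  have -> : \int[mu]_x `|(k x `^ q^-1)%:E| `^ q = \int[mu]_w (k w)%:E.
    apply: eq_integral => w _; rewrite gee0_abs ?lee_fin ?powR_ge0//.
    by rewrite poweR_EFin powK.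
  rewrite -poweR_EFin; apply: gt0_ler_poweR => //.
  + by rewrite subr_ge0 ltW.
  + by rewrite in_itv/= leey andbT.
  + by rewrite in_itv/= leey andbT (le_trans intk0).
- rewrite le_eqVlt; apply/orP; left; apply/eqP; apply: eq_integral => w _.
  rewrite gee0_abs ?lee_fin ?mulr_ge0 ?powR_ge0//.
  by rewrite poweR_EFin powRM ?powR_ge0// powK.
Qed.

(** Bound the p-th power of the inner integral by [integral_powR_le], which uses
    the mass of K(z, .), then exchange the integrals and use the mass of
    K(., w). *)
Lemma schur_test (mu : {sigma_finite_measure set X -> \bar R}) (K : X -> X -> R)
    (g : X -> R) (M p : R) : (1 <= p)%R -> (0 <= M)%R ->
  measurable_fun setT (fun zw : X * X => K zw.1 zw.2) ->
  (forall z w, (0 <= K z w)%R) ->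
  measurable_fun setT g -> (forall w, (0 <= g w)%R) ->
  (forall z, \int[mu]_w (K z w)%:E <= M%:E) ->
  (forall w, \int[mu]_z (K z w)%:E <= M%:E) ->
  \int[mu]_z ((\int[mu]_w (K z w * g w)%:E) `^ p) <=
    (M `^ p)%:E * \int[mu]_w (g w `^ p)%:E.
Proof.
move=> p1 M0 mK K0 mg g0 KMr KMl.
have mKz z : measurable_fun setT (K z).
  exact: (measurableT_comp mK (measurable_pair1 z)).
have mKw w : measurable_fun setT (K ^~ w).
  exact: (measurableT_comp mK (measurable_pair2 w)).
have mgp : measurable_fun setT (fun w => (g w `^ p)%R).
  exact: measurable_fun_powR.
have gp0 w : (0 <= g w `^ p)%R by exact: powR_ge0.
have Kgp0 z w : (0 <= K z w * g w `^ p)%R by rewrite mulr_ge0.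
have mKgp : measurable_fun setT (fun zw : X * X => (K zw.1 zw.2 * g zw.2 `^ p)%:E).
  apply/measurable_EFinP; apply: measurable_funM => //.
  exact: (measurableT_comp mgp measurable_snd).
apply: (@le_trans _ _ (\int[mu]_z
    ((M `^ (p - 1))%:E * \int[mu]_w (K z w * g w `^ p)%:E))).
  apply: le_integral_nonmeasurable => z; first exact: poweR_ge0.
  exact: integral_powR_le.
rewrite ge0_integralZl//; last 3 first.
- by apply: (measurable_fun_fubini_tonelli_F (m2 := mu)
    (fun zw : X * X => (K zw.1 zw.2 * g zw.2 `^ p)%:E)) => // zw; rewrite lee_fin.
- by move=> z _; apply: integral_ge0 => w _; rewrite lee_fin.
- by rewrite lee_fin powR_ge0.
rewrite (fubini_tonelli (m1 := mu) (m2 := mu)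
    (fun zw : X * X => (K zw.1 zw.2 * g zw.2 `^ p)%:E))//=; last first.
  by move=> zw; rewrite lee_fin.
apply: (@le_trans _ _ ((M `^ (p - 1))%:E * \int[mu]_w (M%:E * (g w `^ p)%:E))).
  apply: lee_wpmul2l; first by rewrite lee_fin powR_ge0.
  apply: le_integral_nonmeasurable => w.
    by apply: integral_ge0 => z _; rewrite lee_fin.
  under eq_integral do rewrite EFinM.
  rewrite ge0_integralZr//; last 3 first.
  - exact/measurable_EFinP.
  - by move=> z _; rewrite lee_fin.
  - by rewrite lee_fin.
  by apply: lee_wpmul2r => //; rewrite lee_fin.
rewrite ge0_integralZl//; last 2 first.
- exact/measurable_EFinP.
- by move=> w _; rewrite lee_fin.
rewrite muleA -EFinM mulrC mulr_powRB1//; lra.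
Qed.

End schur.

(** * Gaussian integrals on C^n *)

Section hermitian.
Context {R : realType}.

Lemma enorm_sqrE n (z : n.-tuple R[i]) : enorm z ^+ 2 =
  \sum_(i < n) (complex.Re (tnth z i) ^+ 2 + complex.Im (tnth z i) ^+ 2).
Proof.
rewrite /enorm sqr_sqrtr ?sumr_ge0// => [|i _]; last exact: sqr_ge0.
apply: eq_bigr => i _; case: (tnth z i) => a b /=.
by rewrite sqr_sqrtr// addr_ge0// sqr_ge0.
Qed.

Lemma Re_inner n (z w : n.-tuple R[i]) : complex.Re (inner z w) =
  \sum_(i < n) (complex.Re (tnth z i) * complex.Re (tnth w i) +
                complex.Im (tnth z i) * complex.Im (tnth w i)).
Proof.
rewrite /inner raddf_sum; apply: eq_bigr => i _ /=.
by case: (tnth z i) => a b; case: (tnth w i) => c e /=; rewrite mulrN opprK.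
Qed.

Lemma Im_inner n (z w : n.-tuple R[i]) : complex.Im (inner z w) =
  \sum_(i < n) (complex.Im (tnth z i) * complex.Re (tnth w i) -
                complex.Re (tnth z i) * complex.Im (tnth w i)).
Proof.
rewrite /inner raddf_sum; apply: eq_bigr => i _ /=.
by case: (tnth z i) => a b; case: (tnth w i) => c e /=; ring.
Qed.

Lemma measurable_Re_tnth n (i : 'I_n) :
  measurable_fun setT (fun z : n.-tuple R[i] => complex.Re (tnth z i)).
Proof. exact: (measurableT_comp measurable_Re (measurable_tnth i)). Qed.

Lemma measurable_Im_tnth n (i : 'I_n) :
  measurable_fun setT (fun z : n.-tuple R[i] => complex.Im (tnth z i)).
Proof. exact: (measurableT_comp measurable_Im (measurable_tnth i)). Qed.

Lemma measurable_enorm_sqr n :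
  measurable_fun setT (fun z : n.-tuple R[i] => enorm z ^+ 2).
Proof.
under eq_fun do rewrite enorm_sqrE.
apply: measurable_sum => i; apply: measurable_funD; apply: measurable_funX.
  exact: measurable_Re_tnth.
exact: measurable_Im_tnth.
Qed.

Lemma measurable_Re_inner n : measurable_fun setT
  (fun zw : n.-tuple R[i] * n.-tuple R[i] => complex.Re (inner zw.1 zw.2)).
Proof.
under eq_fun do rewrite Re_inner.
by apply: measurable_sum => i; apply: measurable_funD; apply: measurable_funM;
  [apply: (measurableT_comp (measurable_Re_tnth i))
  |apply: (measurableT_comp (measurable_Re_tnth i))
  |apply: (measurableT_comp (measurable_Im_tnth i))
  |apply: (measurableT_comp (measurable_Im_tnth i))];
  (exact: measurable_fst || exact: measurable_snd).
Qed.

Lemma measurable_Im_inner n : measurable_fun setT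
  (fun zw : n.-tuple R[i] * n.-tuple R[i] => complex.Im (inner zw.1 zw.2)).
Proof.
under eq_fun do rewrite Im_inner.
by apply: measurable_sum => i; apply: measurable_funB; apply: measurable_funM;
  [apply: (measurableT_comp (measurable_Im_tnth i))
  |apply: (measurableT_comp (measurable_Re_tnth i))
  |apply: (measurableT_comp (measurable_Re_tnth i))
  |apply: (measurableT_comp (measurable_Im_tnth i))];
  (exact: measurable_fst || exact: measurable_snd).
Qed.

End hermitian.

Section gaussian_integrals.
Context {R : realType}.
Implicit Types g b : R.
Local Open Scope ereal_scope.

(** Completing the square turns the integrand into a multiple of the normal
    density of mean b / g and variance 1 / (2 g). *)
Lemma integral_gauss1 g b : (0 < g)%R ->
  \int[lebesgue_measure]_x (expR (- (g * x ^+ 2) + 2 * (b * x)))%:E =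
  (Num.sqrt (pi / g) * expR (b ^+ 2 / g))%:E.
Proof.
move=> g0; have gN0 : (g != 0)%R by rewrite gt_eqF.
pose s := Num.sqrt ((2 * g)^-1).
have s20 : (0 < (2 * g)^-1)%R by rewrite invr_gt0 mulr_gt0.
have s0 : (s != 0)%R by rewrite gt_eqF// sqrtr_gt0.
have s2 : (s ^+ 2 = (2 * g)^-1)%R by rewrite sqr_sqrtr// ltW.
have C0 : (0 <= Num.sqrt (pi / g) * expR (b ^+ 2 / g))%R.
  by rewrite mulr_ge0 ?expR_ge0 ?sqrtr_ge0.
transitivity (\int[lebesgue_measure]_x
    ((Num.sqrt (pi / g) * expR (b ^+ 2 / g))%:E * (normal_pdf (b / g) s x)%:E)).
  apply: eq_integral => x _; rewrite -EFinM; congr EFin.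
  rewrite normal_pdfE// /normal_peak /normal_fun s2.
  have -> : ((2 * g)^-1 * pi *+ 2 = pi / g)%R by rewrite -mulr_natr; field.
  rewrite mulrACA mulfV ?mul1r; last first.
    by rewrite gt_eqF// sqrtr_gt0 divr_gt0// pi_gt0.
  rewrite -expRD; congr expR; rewrite -mulr_natr; field.
  by rewrite gN0.
rewrite ge0_integralZl_EFin ?integral_normal_pdf ?mule1//.
- by move=> x _; rewrite lee_fin normal_pdf_ge0.
- by apply/measurable_EFinP; exact: measurable_normal_pdf.
Qed.

Lemma measurable_gauss_complex g (b c : R) : measurable_fun setT (fun z : R[i] =>
  (expR (- (g * (complex.Re z ^+ 2 + complex.Im z ^+ 2)) +
    2 * (b * complex.Re z + c * complex.Im z)))%:E).
Proof.
apply/measurable_EFinP; apply: measurableT_comp => //.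
apply: measurable_funD.
  apply: measurableT_comp => //; apply: measurable_funM => //.
  apply: measurable_funD; apply: measurable_funX;
  [exact: measurable_Re|exact: measurable_Im].
apply: measurable_funM => //; apply: measurable_funD; apply: measurable_funM => //;
  [exact: measurable_Re|exact: measurable_Im].
Qed.

Lemma integral_gauss_complex g (b c : R) : (0 < g)%R ->
  \int[lebesgue_complex]_z
    (expR (- (g * (complex.Re z ^+ 2 + complex.Im z ^+ 2)) +
      2 * (b * complex.Re z + c * complex.Im z)))%:E =
  (pi / g * expR ((b ^+ 2 + c ^+ 2) / g))%:E.
Proof.
move=> g0.
rewrite /lebesgue_complex ge0_integral_pushforward//=; last 2 first.
- exact: measurable_complex_of_pair.
- exact: measurable_gauss_complex.
rewrite preimage_setT fubini_tonelli1//=; last first.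
  exact: (measurableT_comp (measurable_gauss_complex g b c) measurable_complex_of_pair).
have m1 (e : R) : measurable_fun setT
    (fun x : R => (expR (- (g * x ^+ 2) + 2 * (e * x)))%:E).
  apply/measurable_EFinP; apply: measurableT_comp => //.
  apply: measurable_funD; last by do 2 apply: measurable_funM => //.
  apply: measurableT_comp => //; apply: measurable_funM => //.
rewrite /fubini_F.
under eq_integral => x _.
  under eq_integral => y _.
    rewrite /= (_ : (- _ + _ = (- (g * x ^+ 2) + 2 * (b * x)) +
       (- (g * y ^+ 2) + 2 * (c * y)))%R); last by ring.
    rewrite expRD EFinM; over.
  rewrite ge0_integralZl_EFin ?expR_ge0//; last exact: m1.
  rewrite integral_gauss1// muleC.
  over.
rewrite /= ge0_integralZl_EFin//; last exact: m1.
rewrite integral_gauss1// -EFinM; congr EFin.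
rewrite mulrACA -expRD -expr2 sqr_sqrtr; last by rewrite divr_ge0 ?pi_ge0// ltW.
by congr (_ * expR _)%R; ring.
Qed.

Lemma measurable_gauss n g t (z : n.-tuple R[i]) : measurable_fun setT
  (fun w => (expR (- (g * enorm w ^+ 2) + 2 * (t * complex.Re (inner z w))))%:E).
Proof.
apply/measurable_EFinP; apply: measurableT_comp => //.
apply: measurable_funD.
  apply: measurableT_comp => //; apply: measurable_funM => //.
  exact: measurable_enorm_sqr.
do 2 apply: measurable_funM => //.
exact: (measurableT_comp (@measurable_Re_inner R n) (measurable_pair1 z)).
Qed.

(** The integrand is a product over the 2n real coordinates.  All Gaussian
    integrals on C^n that occur below are instances of this one. *)
Lemma integral_gauss n g t (z : n.-tuple R[i]) : (0 < g)%R ->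
  \int[volume n]_w
    (expR (- (g * enorm w ^+ 2) + 2 * (t * complex.Re (inner z w))))%:E =
  ((pi / g) ^+ n * expR (t ^+ 2 * enorm z ^+ 2 / g))%:E.
Proof.
move=> g0; elim: n z => [z|n ih z].
  rewrite integral_dirac//; last exact: measurable_gauss.
  by rewrite diracT mul1e !enorm_sqrE Re_inner !big_ord0 !mulr0 mul0r oppr0 addr0 expR0 mulr1.
case/tupleP: z => z0 z.
rewrite /= /lebesgue_cons ge0_integral_pushforward//=; last 2 first.
- exact: measurable_cons_pair.
- exact: measurable_gauss.
rewrite preimage_setT fubini_tonelli1//=; last first.
  by apply: (measurableT_comp (measurable_gauss g t [tuple of z0 :: z])); exact: measurable_cons_pair.
rewrite /fubini_F.
have enormS (x : R[i]) (v : n.-tuple R[i]) : (enorm [tuple of x :: v] ^+ 2 =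
    (complex.Re x ^+ 2 + complex.Im x ^+ 2) + enorm v ^+ 2)%R.
  rewrite !enorm_sqrE big_ord_recl tnth0; congr (_ + _)%R.
  by apply: eq_bigr => i _; rewrite tnthS.
under eq_integral => x _.
  under eq_integral => y _.
    rewrite /= (_ : (- _ + _ =
       (- (g * (complex.Re x ^+ 2 + complex.Im x ^+ 2)) +
          2 * ((t * complex.Re z0) * complex.Re x + (t * complex.Im z0) * complex.Im x)) +
       (- (g * enorm y ^+ 2) + 2 * (t * complex.Re (inner z y))))%R); last first.
      rewrite enormS !Re_inner big_ord_recl !tnth0/=.
      under eq_bigr do rewrite !tnthS.
      by ring.
    rewrite expRD EFinM; over.
  rewrite ge0_integralZl_EFin ?expR_ge0//; last exact: measurable_gauss.
  rewrite ih// muleC.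
  over.
rewrite /= ge0_integralZl_EFin//; last 2 first.
- exact: measurable_gauss_complex.
- by rewrite mulr_ge0 ?expR_ge0// exprn_ge0// divr_ge0 ?pi_ge0// ltW.
rewrite integral_gauss_complex// -EFinM; congr EFin.
rewrite enormS [((pi / g) ^+ n.+1)%R]exprSr mulrACA -expRD.
by congr (_ * expR _)%R; ring.
Qed.

End gaussian_integrals.

Section gaussian_measure.
Context {R : realType} (n : nat).
Implicit Types r : {posnum R}.

Lemma integral_gaussian r (f : n.-tuple R[i] -> \bar R) :
  measurable_fun setT f -> (forall z, 0 <= f z)%E ->
  (\int[gaussian n r]_z f z =
   \int[volume n]_z (f z * (gaussian_density r z)%:E))%E.
Proof.
move=> mf f0; apply: integral_density => //.
- exact: measurable_gaussian_density.
- exact: gaussian_density_ge0.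
Qed.

Lemma gaussianT r : gaussian n r setT = 1%E.
Proof.
rewrite /gaussian /gaussian_density.
under eq_integral do rewrite EFinM.
rewrite ge0_integralZl_EFin//; last 2 first.
- apply/measurable_EFinP; apply: measurableT_comp => //.
  apply: measurableT_comp => //; apply: measurable_funM => //.
  exact: measurable_enorm_sqr.
- by rewrite exprn_ge0// divr_ge0// pi_ge0.
rewrite (_ : (\int[volume n]_z _)%E = ((pi / r%:num) ^+ n)%:E).
  rewrite -EFinM -exprMn mulrA divfK ?mulfV ?expr1n//.
  by rewrite gt_eqF// pi_gt0.
have := @integral_gauss R n r%:num 0 [tuple of nseq n 0] ltac:(by []).
rewrite expr0n/= !mul0r expR0 mulr1 => <-.
by apply: eq_integral => w _; rewrite mul0r mulr0 addr0.
Qed.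

End gaussian_measure.

(** * The kernels *)

Section kernels.
Context {R : realType} (n : nat) (t : {posnum R}).
Implicit Types (z w : n.-tuple R[i]) (k : n.-tuple R[i] -> n.-tuple R[i] -> R[i]).

(** The properties of the kernels of S and T through which both operators are
    treated at once: their common modulus serves for the upper bound, the lower
    bound on the real part for the test on cubes. *)
Record exponential_kernel k : Prop := ExponentialKernel {
  kernel_measurable : measurable_fun setT (fun zw => k zw.1 zw.2);
  normc_kernel : forall z w, normc (k z w) = expR (t%:num * complex.Re (inner z w));
  Re_kernel : forall z w,
    expR (t%:num * complex.Re (inner z w)) * cos (t%:num * complex.Im (inner z w))
      <= complex.Re (k z w) }.

Lemma normc_S_kernel z w :
  normc (S_kernel t z w) = expR (t%:num * complex.Re (inner z w)).
Proof.
rewrite /S_kernel /cexp normcM Re_scaled Im_scaled /=.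
by rewrite cos2Dsin2 sqrtr1 mulr1 expr0n/= addr0 sqrtr_sqr ger0_norm ?expR_ge0.
Qed.

Lemma exponential_S_kernel : exponential_kernel (S_kernel t).
Proof.
have mexp : measurable_fun setT (fun zw : n.-tuple R[i] * n.-tuple R[i] =>
    expR (t%:num * complex.Re (inner zw.1 zw.2))).
  apply: measurableT_comp => //; apply: measurable_funM => //.
  exact: measurable_Re_inner.
have mph : measurable_fun setT (fun zw : n.-tuple R[i] * n.-tuple R[i] =>
    t%:num * complex.Im (inner zw.1 zw.2)).
  by apply: measurable_funM => //; exact: measurable_Im_inner.
split.
- apply: measurable_complex_pair.
    under eq_fun do rewrite /S_kernel /cexp Re_scaled Re_scaled Im_scaled.
    apply: measurable_funM => //=.
    apply: (measurableT_comp _ mph) => //.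
    exact: (continuous_measurable_fun (@continuous_cos R)).
  under eq_fun do rewrite /S_kernel /cexp Im_scaled Re_scaled Im_scaled.
  apply: measurable_funM => //=.
  apply: (measurableT_comp _ mph) => //.
  exact: (continuous_measurable_fun (@continuous_sin R)).
- exact: normc_S_kernel.
- by move=> z w; rewrite /S_kernel /cexp !Re_scaled Im_scaled.
Qed.

Lemma T_kernelE z w :
  T_kernel t z w = (expR (t%:num * complex.Re (inner z w)))%:C%C.
Proof. by rewrite /T_kernel -normc_S_kernel. Qed.

Lemma exponential_T_kernel : exponential_kernel (T_kernel t).
Proof.
split.
- apply: measurable_complex_pair.
    under eq_fun do rewrite T_kernelE/=.
    apply: measurableT_comp => //; apply: measurable_funM => //.
    exact: measurable_Re_inner.
  by under eq_fun do rewrite T_kernelE/=; exact: measurable_cst.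
- by move=> z w; rewrite T_kernelE normc_real ?expR_ge0.
- by move=> z w; rewrite T_kernelE/= ler_piMr ?expR_ge0// cos_le1.
Qed.

End kernels.

(** * Upper bound *)

Section upper_bound.
Context {R : realType} (n : nat) (t s : {posnum R}) (p : R).
Hypotheses (p1 : 1 <= p) (pt2s : p * t%:num = 2 * s%:num).
Variable k : n.-tuple R[i] -> n.-tuple R[i] -> R[i].
Hypothesis kP : exponential_kernel t k.
Local Notation C_n := (n.-tuple R[i]).

Let p0 : 0 < p. Proof. by rewrite (lt_le_trans _ p1). Qed.
Let a := t%:num / 2.
Let a0 : 0 < a. Proof. by rewrite divr_gt0. Qed.

(** This is (t / pi)^n exp (- t |z - w|^2 / 2), a convolution kernel.
    It is the kernel of T, taken relative to dv, conjugated by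
    f |-> f exp (- t |.|^2 / 2); for p t = 2 s this map is, up to a constant
    factor, an isometry of L^p(dv_s) onto L^p(dv). *)
Definition gauss_kernel (z w : C_n) : R :=
  (t%:num / pi) ^+ n * expR (t%:num * complex.Re (inner z w)
    - t%:num / 2 * enorm z ^+ 2 - t%:num / 2 * enorm w ^+ 2).

Lemma Re_innerC (z w : C_n) : complex.Re (inner z w) = complex.Re (inner w z).
Proof. by rewrite !Re_inner; apply: eq_bigr => i _; ring. Qed.

Lemma gauss_kernelC z w : gauss_kernel z w = gauss_kernel w z.
Proof. by rewrite /gauss_kernel Re_innerC addrAC. Qed.

Lemma gauss_kernel_ge0 z w : 0 <= gauss_kernel z w.
Proof. by rewrite mulr_ge0 ?expR_ge0// exprn_ge0// divr_ge0 ?pi_ge0. Qed.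

Lemma measurable_gauss_kernel :
  measurable_fun setT (fun zw : C_n * C_n => gauss_kernel zw.1 zw.2).
Proof.
apply: measurable_funM => //; apply: measurableT_comp => //.
apply: measurable_funB.
  apply: measurable_funB; apply: measurable_funM => //.
    exact: measurable_Re_inner.
  exact: (measurableT_comp (@measurable_enorm_sqr R n) measurable_fst).
apply: measurable_funM => //.
exact: (measurableT_comp (@measurable_enorm_sqr R n) measurable_snd).
Qed.

Lemma integral_gauss_kernel z :
  (\int[volume n]_w (gauss_kernel z w)%:E = (2 ^+ n)%:E)%E.
Proof.
transitivity (\int[volume n]_w
  (((t%:num / pi) ^+ n * expR (- (a * enorm z ^+ 2)))%:E *
  (expR (- (a * enorm w ^+ 2) + 2 * (a * complex.Re (inner z w))))%:E))%E.
  apply: eq_integral => w _; rewrite -EFinM -mulrA -expRD; congr (_ * expR _)%:E.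
  by rewrite /a; field.
rewrite ge0_integralZl_EFin//; last 2 first.
- exact: measurable_gauss.
- by rewrite mulr_ge0 ?expR_ge0// exprn_ge0// divr_ge0 ?pi_ge0.
rewrite integral_gauss// -EFinM mulrACA -expRD -[X in (X * _)%:E]exprMn.
have piN0 : pi != 0 :> R by rewrite gt_eqF// pi_gt0.
have -> : t%:num / pi * (pi / a) = 2.
  by move: pi piN0 => q qN0; rewrite /a; field; rewrite qN0 gt_eqF.
have -> : - (a * enorm z ^+ 2) + a ^+ 2 * enorm z ^+ 2 / a = 0.
  by field; rewrite gt_eqF.
by rewrite expR0 mulr1.
Qed.

Variable f : C_n -> R[i].
Hypothesis mf : measurable_fun setT f.

Let mnf : measurable_fun setT (fun w => normc (f w)).
Proof. exact: measurableT_comp measurable_normc mf. Qed.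

Let nf0 w : 0 <= normc (f w).
Proof. exact: normc_ge0. Qed.

Let mexpN (c : R) : measurable_fun setT (fun w : C_n => expR (c * enorm w ^+ 2)).
Proof.
apply: measurableT_comp => //; apply: measurable_funM => //.
exact: measurable_enorm_sqr.
Qed.

(** The image of |f| under T, with values in the extended reals so that it makes
    sense at points where the defining integral diverges. *)
Definition abs_intop (z : C_n) : \bar R :=
  (\int[gaussian n t]_w (normc (k z w * f w))%:E)%E.

Lemma abs_intop_ge0 z : (0 <= abs_intop z)%E.
Proof.
by apply: integral_ge0 => w _; rewrite lee_fin normc_ge0.
Qed.

Lemma measurable_kernelM : measurable_fun setT
  (fun zw : C_n * C_n => k zw.1 zw.2 * f zw.2).
Proof.
apply: measurable_complexM; first exact: kernel_measurable kP.
exact: (measurableT_comp mf measurable_snd).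
Qed.

Let mknf z : measurable_fun setT (fun w => (normc (k z w * f w))%:E).
Proof.
apply/measurable_EFinP; apply: (measurableT_comp measurable_normc).
exact: (measurableT_comp measurable_kernelM (measurable_pair1 z)).
Qed.

Lemma abs_intopE z : abs_intop z =
  ((expR (a * enorm z ^+ 2))%:E *
   \int[volume n]_w (gauss_kernel z w *
     (normc (f w) * expR (- a * enorm w ^+ 2)))%:E)%E.
Proof.
rewrite /abs_intop integral_gaussian//; last first.
  by move=> w; rewrite lee_fin normc_ge0.
rewrite -ge0_integralZl_EFin ?expR_ge0//; last 2 first.
- by move=> w _; rewrite lee_fin mulr_ge0 ?gauss_kernel_ge0// mulr_ge0 ?expR_ge0.
- apply/measurable_EFinP; apply: measurable_funM.
    exact: (measurableT_comp measurable_gauss_kernel (measurable_pair1 z)).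
  exact: measurable_funM.
apply: eq_integral => w _; rewrite -!EFinM; congr EFin.
rewrite normcM (normc_kernel kP) /gaussian_density /gauss_kernel.
have expE : expR (t%:num * complex.Re (inner z w)) *
    expR (- (t%:num * enorm w ^+ 2)) =
  expR (a * enorm z ^+ 2) * expR (t%:num * complex.Re (inner z w) -
    t%:num / 2 * enorm z ^+ 2 - t%:num / 2 * enorm w ^+ 2) *
    expR (- a * enorm w ^+ 2).
  by rewrite -!expRD; congr expR; rewrite /a; field.
transitivity ((t%:num / pi) ^+ n * normc (f w) *
    (expR (t%:num * complex.Re (inner z w)) * expR (- (t%:num * enorm w ^+ 2)))).
  by ring.
by rewrite expE; ring.
Qed.

Lemma measurable_abs_intop : measurable_fun setT abs_intop.
Proof.
rewrite (funext abs_intopE).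
apply: emeasurable_funM.
  by apply/measurable_EFinP; exact: mexpN.
apply: (measurable_fun_fubini_tonelli_F (m2 := volume n)
  (fun zw : C_n * C_n => (gauss_kernel zw.1 zw.2 *
     (normc (f zw.2) * expR (- a * enorm zw.2 ^+ 2)))%:E)).
- apply/measurable_EFinP; apply: measurable_funM.
    exact: measurable_gauss_kernel.
  exact: (measurableT_comp (measurable_funM mnf (mexpN (- a))) measurable_snd).
- by move=> zw; rewrite lee_fin mulr_ge0 ?gauss_kernel_ge0// mulr_ge0 ?expR_ge0.
Qed.

(** Schur's test for [gauss_kernel], whose two marginal masses are 2^n; the
    weights cancel because p t / 2 = s. *)
Lemma abs_intop_pnorm :
  (\int[gaussian n s]_z (abs_intop z `^ p) <=
   ((2 ^+ n) `^ p)%:E * \int[gaussian n s]_z (normc (f z) `^ p)%:E)%E.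
Proof.
have as_ : a * p = s%:num
  by rewrite /a mulrAC [_ * p]mulrC pt2s mulrAC mulfV ?mul1r.
pose g w := normc (f w) * expR (- a * enorm w ^+ 2).
have g0 w : 0 <= g w by rewrite mulr_ge0 ?expR_ge0.
have mg : measurable_fun setT g by exact: measurable_funM.
have cs0 : 0 <= (s%:num / pi) ^+ n :> R.
  by rewrite exprn_ge0// divr_ge0// pi_ge0.
have expRp (c : R) : expR c `^ p = expR (c * p).
  by rewrite -expRM.
rewrite !integral_gaussian; last 4 first.
- by apply/measurable_EFinP; exact: measurable_fun_powR.
- by move=> z; rewrite lee_fin powR_ge0.
- exact: (measurableT_comp (measurable_poweR p) measurable_abs_intop).
- by move=> z; exact: poweR_ge0.
rewrite [leLHS](_ : _ = ((s%:num / pi) ^+ n)%:E * \int[volume n]_z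
    ((\int[volume n]_w (gauss_kernel z w * g w)%:E) `^ p))%E; last first.
  rewrite -ge0_integralZl_EFin//; last 2 first.
  - by move=> z _; exact: poweR_ge0.
  - apply: (measurableT_comp (measurable_poweR p)).
    apply: (measurable_fun_fubini_tonelli_F (m2 := volume n)
      (fun zw : C_n * C_n => (gauss_kernel zw.1 zw.2 * g zw.2)%:E)).
    + apply/measurable_EFinP; apply: measurable_funM.
        exact: measurable_gauss_kernel.
      exact: (measurableT_comp mg measurable_snd).
    + by move=> zw; rewrite lee_fin mulr_ge0// gauss_kernel_ge0.
  apply: eq_integral => z _; rewrite abs_intopE poweRM//; last first.
    apply: integral_ge0 => w _.
    by rewrite lee_fin mulr_ge0 ?gauss_kernel_ge0// mulr_ge0 ?expR_ge0.
  rewrite poweR_EFin expRp muleAC -EFinM; congr (_%:E * _)%E.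
  rewrite /gaussian_density mulrCA -expRD.
  by rewrite mulrAC as_ subrr expR0 mulr1.
rewrite [X in (_ <= _ * X)%E](_ : _ = ((s%:num / pi) ^+ n)%:E *
    \int[volume n]_w (g w `^ p)%:E)%E; last first.
  rewrite -ge0_integralZl_EFin//; last 2 first.
  - by move=> z _; rewrite lee_fin powR_ge0.
  - by apply/measurable_EFinP; exact: measurable_fun_powR.
  apply: eq_integral => z _; rewrite -!EFinM; congr EFin.
  rewrite /g powRM ?expR_ge0// expRp /gaussian_density mulrCA; congr (_ * (_ * expR _)).
  by rewrite mulrAC mulNr as_ mulNr.
rewrite muleCA lee_wpmul2l ?lee_fin//.
apply: schur_test => //.
- exact: measurable_gauss_kernel.
- exact: gauss_kernel_ge0.
- by move=> z; rewrite integral_gauss_kernel.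
- move=> w; under eq_integral do rewrite gauss_kernelC.
  by rewrite integral_gauss_kernel.
Qed.

Lemma normc_intop_le z : ((normc (intop (gaussian n t) k f z))%:E <= abs_intop z)%E.
Proof.
apply: normc_cintegral_le.
exact: (measurableT_comp measurable_kernelM (measurable_pair1 z)).
Qed.

Lemma cLnorm_intop_le : (cLnorm (gaussian n s) p (intop (gaussian n t) k f) <=
  (2 ^+ n)%:E * cLnorm (gaussian n s) p f)%E.
Proof.
apply: (@le_trans _ _ (Lnorm (gaussian n s) p%:E abs_intop)).
  apply: le_Lnorm_nonmeasurable => // z.
  rewrite gee0_abs ?lee_fin ?normc_ge0//.
  by rewrite gee0_abs ?abs_intop_ge0// normc_intop_le.
apply: le_scaled_Lnorm => //.
rewrite (_ : (\int[_]_x _)%E = (\int[gaussian n s]_z (abs_intop z `^ p))%E).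
  rewrite [X in (_ <= _ * X)%E](_ : _ = (\int[gaussian n s]_z (normc (f z) `^ p)%:E)%E).
    exact: abs_intop_pnorm.
  by apply: eq_integral => z _; rewrite gee0_abs ?lee_fin// poweR_EFin.
by apply: eq_integral => z _; rewrite gee0_abs//; exact: abs_intop_ge0.
Qed.

(** The p-th power of [abs_intop] has a finite integral. *)
Lemma cintegrable_kernel_ae : (cLnorm (gaussian n s) p f < +oo)%E ->
  {ae gaussian n s, forall z, cintegrable (gaussian n t) (fun w => k z w * f w)}.
Proof.
move=> foo.
have Foo : (\int[gaussian n s]_z (normc (f z) `^ p)%:E < +oo)%E.
  have E : (cLnorm (gaussian n s) p f `^ p)%E =
      (\int[gaussian n s]_z (normc (f z) `^ p)%:E)%E.
    rewrite /cLnorm.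
rewrite poweR_Lnorm.

    apply: eq_integral => z _.
rewrite gee0_abs.
by rewrite poweR_EFin.
by rewrite lee_fin.
by rewrite gt_eqF.
rewrite -E.
exact: poweR_lty.
have mFp : measurable_fun setT (fun z => (abs_intop z `^ p)%E).
  exact: (measurableT_comp (measurable_poweR p) measurable_abs_intop).
have : (gaussian n s).-integrable setT (fun z => (abs_intop z `^ p)%E).
  apply/integrableP; split => //.
  under eq_integral do rewrite gee0_abs ?poweR_ge0//.
  apply: le_lt_trans abs_intop_pnorm _.
  by rewrite lte_mul_pinfty// lee_fin powR_ge0.
move=> /(integrable_ae measurableT); apply: filterS => z /(_ I).
rewrite ge0_fin_numE; last exact: poweR_ge0.
move=> Fz; split.
  exact: (measurableT_comp measurable_kernelM (measurable_pair1 z)).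
by apply: (lty_poweRy _ Fz); rewrite gt_eqF.
Qed.

End upper_bound.

(** * Lower bound for the norm of T *)

Section T_lower_bound.
Context {R : realType} (n : nat) (t s : {posnum R}) (p : R).
Hypotheses (p1 : 1 <= p) (pt2s : p * t%:num = 2 * s%:num).
Local Notation C_n := (n.-tuple R[i]).

Let p0 : 0 < p. Proof. by rewrite (lt_le_trans _ p1). Qed.
Let a := t%:num / 2.
Let a0 : 0 < a. Proof. by rewrite divr_gt0. Qed.

Variable e : R.
Hypothesis e0 : 0 < e.

(** For p t = 2 s this function is in L^p(dv_s) exactly when e > 0, and it is
    nearly extremal for T when e is small: in the convolution picture it becomes
    the wide Gaussian exp (- e |z|^2). *)
Definition gauss_test (z : C_n) : R[i] := (expR ((a - e) * enorm z ^+ 2))%:C%C.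

Let mexpN (c : R) : measurable_fun setT (fun w : C_n => expR (c * enorm w ^+ 2)).
Proof.
apply: measurableT_comp => //; apply: measurable_funM => //.
exact: measurable_enorm_sqr.
Qed.

Lemma normc_gauss_test z : normc (gauss_test z) = expR ((a - e) * enorm z ^+ 2).
Proof. by rewrite normc_real ?expR_ge0. Qed.

Lemma integral_gauss_test : (\int[gaussian n s]_z (normc (gauss_test z) `^ p)%:E =
  ((s%:num / pi) ^+ n * (pi / (p * e)) ^+ n)%:E)%E.
Proof.
have pe0 : 0 < p * e by rewrite mulr_gt0.
have as_ : a * p = s%:num.
  by rewrite /a mulrAC [_ * p]mulrC pt2s mulrAC mulfV ?mul1r.
rewrite integral_gaussian//; last 2 first.
- apply/measurable_EFinP; apply: measurable_fun_powR.
  by rewrite (_ : (fun z => _) = (fun z => expR ((a - e) * enorm z ^+ 2)));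
    [exact: mexpN|exact/funext/normc_gauss_test].
- by move=> z; rewrite lee_fin powR_ge0.
transitivity (\int[volume n]_w (((s%:num / pi) ^+ n)%:E * (expR (- (p * e * enorm w ^+ 2) +
    2 * (0 * complex.Re (inner [tuple of nseq n 0%C] w))))%:E))%E.
  apply: eq_integral => z _; rewrite normc_gauss_test -!EFinM; congr EFin.
  rewrite -expRM /gaussian_density mulrCA -expRD; congr (_ * expR _).
  by rewrite -as_; ring.
rewrite ge0_integralZl_EFin//; last 2 first.
- exact: measurable_gauss.
- by rewrite exprn_ge0// divr_ge0// pi_ge0.
by rewrite integral_gauss// expr0n/= !mul0r expR0 mulr1 -EFinM.
Qed.

(** The image of [gauss_test] is (t / (a + e))^n exp (a^2 |z|^2 / (a + e)), and
    a^2 >= (a - e) (a + e): the operator multiplies [gauss_test] pointwise by at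
    least (t / (a + e))^n. *)
Lemma Re_T_gauss_test z :
  (t%:num / (a + e)) ^+ n * normc (gauss_test z) <=
  complex.Re (intop (gaussian n t) (T_kernel t) gauss_test z).
Proof.
have ae0 : 0 < a + e by rewrite addr_gt0.
rewrite normc_gauss_test -[leRHS]/(fine (\int[gaussian n t]_w
  (complex.Re (T_kernel t z w * gauss_test w))%:E)%E).
rewrite (_ : (\int[_]_x _)%E =
  ((t%:num / (a + e)) ^+ n * expR (a ^+ 2 * enorm z ^+ 2 / (a + e)))%:E).
  rewrite [fine _]/= ler_wpM2l ?exprn_ge0 ?divr_ge0 ?(ltW ae0)//.
  rewrite ler_expR.
  rewrite mulrAC ler_wpM2r ?sqr_ge0// ler_pdivlMr//.
  by rewrite -subr_sqr lerBlDr lerDl sqr_ge0.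
transitivity (\int[gaussian n t]_w
  (expR (t%:num * complex.Re (inner z w)) * expR ((a - e) * enorm w ^+ 2))%:E)%E.
  by apply: eq_integral => w _; rewrite T_kernelE Re_scaled.
rewrite integral_gaussian; last 2 first.
- apply/measurable_EFinP; apply: measurable_funM => //.
  apply: measurableT_comp => //; apply: measurable_funM => //.
  exact: (measurableT_comp (@measurable_Re_inner R n) (measurable_pair1 z)).
- by move=> w; rewrite lee_fin mulr_ge0 ?expR_ge0.
transitivity (\int[volume n]_w (((t%:num / pi) ^+ n)%:E *
    (expR (- ((a + e) * enorm w ^+ 2) + 2 * (a * complex.Re (inner z w))))%:E))%E.
  apply: eq_integral => w _; rewrite -!EFinM; congr EFin.
  rewrite /gaussian_density mulrCA -!expRD; congr (_ * expR _).
  by rewrite /a; field.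
rewrite ge0_integralZl_EFin//; last 2 first.
- exact: measurable_gauss.
- by rewrite exprn_ge0// divr_ge0// pi_ge0.
rewrite integral_gauss// -EFinM mulrA -exprMn; congr (_ ^+ n * _)%:E.
by rewrite mulrA divfK// gt_eqF// pi_gt0.
Qed.

Lemma T_bound_ge (C : R) :
  intop_bound (gaussian n t) (T_kernel t) (gaussian n s) p C ->
  (t%:num / (a + e)) ^+ n <= C.
Proof.
move=> bC; set c := _ ^+ n.
have c0 : 0 <= c by rewrite exprn_ge0// divr_ge0// ltW// addr_gt0.
have pe0 : 0 < p * e by rewrite mulr_gt0.
pose N := cLnorm (gaussian n s) p gauss_test.
pose I := (s%:num / pi) ^+ n * (pi / (p * e)) ^+ n.
have NE : N = (I `^ p^-1)%:E.
  rewrite /N /cLnorm unlock (_ : (\int[_]_x _)%E = I%:E)//.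
  rewrite -integral_gauss_test; apply: eq_integral => z _.
  by rewrite gee0_abs// lee_fin normc_gauss_test expR_ge0.
have N0 : 0 < I `^ p^-1.
  by rewrite powR_gt0// mulr_gt0// exprn_gt0// divr_gt0// pi_gt0.
have inLp : in_Lp (gaussian n s) p gauss_test.
  split; last by rewrite -/N NE ltry.
  by apply: measurable_complex_pair => //=.
have := bC _ inLp; rewrite -/N => TN.
have : (c%:E * N <= C%:E * N)%E.
  apply: le_trans TN.
  rewrite /N /cLnorm mul_Lnorm_EFin//; last first.
    by apply: measurableT_comp inLp.1; exact: measurable_normc.
  apply: le_Lnorm_nonmeasurable => // z.
  rewrite gee0_abs; last by rewrite lee_fin mulr_ge0// normc_gauss_test expR_ge0.
  rewrite abse_EFin lee_fin; apply: le_trans (Re_T_gauss_test z) _.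
  by apply: le_trans (Re_le_normc _) (ler_norm _).
by rewrite NE -!EFinM lee_fin ler_pM2r.
Qed.

End T_lower_bound.

(** The bound t / (t / 2 + e) tends to 2 as e tends to 0. *)
Lemma T_bound_ge2n {R : realType} (n : nat) (t s : {posnum R}) (p C : R) :
  1 <= p -> p * t%:num = 2 * s%:num ->
  intop_bound (gaussian n t) (T_kernel t) (gaussian n s) p C -> 2 ^+ n <= C.
Proof.
move=> p1 pt2s bC.
have : (fun e : R => (t%:num / (t%:num / 2 + e)) ^+ n) e @[e --> 0^'+] --> (2 : R) ^+ n.
  rewrite (_ : (2 : R) ^+ n = (t%:num / (t%:num / 2 + 0)) ^+ n); last first.
    by congr (_ ^+ n); field.
  apply: cvg_at_right_filter.
  apply: (@cvg_comp _ _ _ (fun e : R => t%:num / (t%:num / 2 + e)) (fun x => x ^+ n)); last first.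
    exact: exprn_continuous.
  apply: cvgM; first exact: cvg_cst.
  apply: cvgV; first by rewrite addr0 gt_eqF.
  by apply: cvgD; [exact: cvg_cst|exact: cvg_id].
move=> /cvgr_to_le; apply.
near=> e.
apply: T_bound_ge bC => //.
Unshelve. all: by end_near. Qed.

(** * Indicators of cubes *)

Section indicator_test.
Context d {X : measurableType d} {R : realType}.
Local Open Scope ereal_scope.

Lemma Lnorm_indic (mu : {measure set X -> \bar R}) (p : R) (A : set X) :
  (0 < p)%R -> measurable A ->
  Lnorm mu p%:E (fun x => (\1_A x)%:E) = mu A `^ p^-1.
Proof.
move=> p0 mA; rewrite unlock; congr poweR.
have <- : \int[mu]_x (\1_A x)%:E = mu A by rewrite integral_indic// setIT.
apply: eq_integral => x _.
rewrite gee0_abs ?lee_fin// poweR_EFin indicE.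
by case: (x \in A); rewrite ?powR1// powR0// gt_eqF.
Qed.

Definition cindic (A : set X) (x : X) : R[i] := (\1_A x)%:C%C.

Lemma normc_cindic A x : normc (cindic A x) = \1_A x.
Proof. by rewrite normc_real. Qed.

Lemma measurable_cindic A : measurable A -> measurable_fun setT (cindic A).
Proof.
by move=> mA; apply: measurable_complex_pair => //=; exact: measurable_indic.
Qed.

Lemma cLnorm_cindic (mu : {measure set X -> \bar R}) (p : R) (A : set X) :
  (0 < p)%R -> measurable A -> cLnorm mu p (cindic A) = mu A `^ p^-1.
Proof.
move=> p0 mA; rewrite -Lnorm_indic// /cLnorm; congr Lnorm; apply/funext => x.
by rewrite normc_cindic.
Qed.

(** On [A], the real part of the image of the indicator of [B] is at least
    m nu(B).  The bound on [k z] over [B] makes this real part a genuine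
    integral: a divergent one would be given the value 0. *)
Lemma intop_bound_indic (nu mu : {measure set X -> \bar R}) (k : X -> X -> R[i])
    (p C m : R) (A B : set X) :
  (0 < p)%R -> (0 <= m)%R -> measurable A -> measurable B ->
  (nu B < +oo) -> (mu B < +oo) ->
  (forall z, exists M : R, forall w, B w -> (normc (k z w) <= M)%R) ->
  (forall z w, A z -> B w -> (m <= complex.Re (k z w))%R) ->
  intop_bound nu k mu p C ->
  (m * fine (nu B))%:E * mu A `^ p^-1 <= C%:E * mu B `^ p^-1.
Proof.
move=> p0 m0 mA mB nuB muB kM km bC.
have inLp : in_Lp mu p (cindic B).
  split; first exact: measurable_cindic.
  by rewrite cLnorm_cindic// poweR_lty.
have := bC _ inLp; rewrite cLnorm_cindic//; apply: le_trans.
have nuB0 : (0 <= fine (nu B))%R by exact: fine_ge0.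
rewrite -Lnorm_indic// mul_Lnorm_EFin ?mulr_ge0//.
apply: le_Lnorm_nonmeasurable => // z.
rewrite !abse_EFin lee_fin ger0_norm ?mulr_ge0// indicE.
case: (boolP (z \in A)) => [|_]; last by rewrite mulr0.
rewrite inE => Az; rewrite mulr1.
apply: le_trans (ler_norm _); apply: le_trans (Re_le_normc _).
rewrite -[leRHS]/(fine (\int[nu]_w (complex.Re (k z w * cindic B w))%:E)).
have [M0 kzM0] := kM z; pose M := Num.max M0 0%R.
have kzM w : B w -> (normc (k z w) <= M)%R.
  by move=> /kzM0 kzw; rewrite le_max kzw.
have fin1 (r : R) : (0 <= r)%R ->
    \int[nu]_w (r * \1_B w)%:E = (r * fine (nu B))%:E.
  move=> r0; under eq_integral do rewrite EFinM.
  rewrite ge0_integralZl_EFin//; last first.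
    by apply/measurable_EFinP; exact: measurable_indic.
  by rewrite integral_indic// setIT EFinM fineK// ge0_fin_numE.
have ReE w : (complex.Re (k z w * cindic B w) = complex.Re (k z w) * \1_B w)%R.
  by rewrite mulrC /cindic Re_scaled mulrC.
have le1 w : (m * \1_B w <= complex.Re (k z w * cindic B w))%R.
  rewrite ReE indicE; case: (boolP (w \in B)) => [|_]; last by rewrite !mulr0.
  by rewrite inE !mulr1 => Bw; exact: km.
have le2 w : (complex.Re (k z w * cindic B w) <= M * \1_B w)%R.
  rewrite ReE indicE; case: (boolP (w \in B)) => [|_]; last by rewrite !mulr0.
  by rewrite inE !mulr1 => Bw; exact: le_trans (Re_le_normc _) (kzM _ Bw).
have ge0 w : (0 <= complex.Re (k z w * cindic B w))%R.
  by apply: le_trans (le1 w); rewrite mulr_ge0.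
rewrite -lee_fin fineK; last first.
  rewrite ge0_fin_numE; last by apply: integral_ge0 => w _; rewrite lee_fin.
  apply: (@le_lt_trans _ _ (\int[nu]_w (M * \1_B w)%:E)).
    by apply: le_integral_nonmeasurable => w; rewrite lee_fin.
  by rewrite fin1 ?ltry// le_max lexx orbT.
rewrite -fin1//; apply: le_integral_nonmeasurable => w; rewrite lee_fin//.
by rewrite mulr_ge0.
Qed.

End indicator_test.

Section boxes.
Context {R : realType} (n : nat).
Implicit Types c h : R.
Local Notation C_n := (n.-tuple R[i]).

(** The cube of side [h] with one corner at c times the first basis vector,
    which has index 0. *)
Definition box c h : set C_n := [set w | forall i : 'I_n,
  (complex.Re (tnth w i) \in `[c * (i == 0 :> nat)%:R, c * (i == 0 :> nat)%:R + h]%R) /\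
  (complex.Im (tnth w i) \in `[0, h]%R)].

Let side c h (i : 'I_n) : set R[i] := [set x |
  (complex.Re x \in `[c * (i == 0 :> nat)%:R, c * (i == 0 :> nat)%:R + h]%R) /\
  (complex.Im x \in `[0, h]%R)].

Let sideE c h i : complex_of_pair @^-1` (side c h i) =
  `[c * (i == 0 :> nat)%:R, c * (i == 0 :> nat)%:R + h] `*` `[0, h].
Proof. by []. Qed.

Let measurable_side c h i : measurable (side c h i).
Proof.
rewrite (_ : side c h i =
  (setT `&` @complex.Re R @^-1`
    `[c * (i == 0 :> nat)%:R, c * (i == 0 :> nat)%:R + h]) `&`
  (setT `&` @complex.Im R @^-1` `[0, h])); last by rewrite !setTI.
apply: measurableI.
  by apply: measurable_Re => //; exact: measurable_itv.
by apply: measurable_Im => //; exact: measurable_itv.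
Qed.

Lemma measurable_box c h : measurable (box c h).
Proof.
rewrite (_ : box c h = \bigcap_(i in [set: 'I_n])
    ((fun w : C_n => tnth w i) @^-1` side c h i)); last first.
  by apply/seteqP; split => [w wb i _|w wb i]; [exact: wb|exact: (wb i I)].
apply: fin_bigcap_measurable => // i _; rewrite -[X in measurable X]setTI.
exact: measurable_tnth.
Qed.

Lemma volume_box c h : 0 <= h -> volume n (box c h) = ((h ^+ 2) ^+ n)%:E.
Proof.
move=> h0; rewrite [X in volume n X](_ : _ =
  [set z : C_n | forall i, side c h i (tnth z i)])//.
rewrite volumeE//.
rewrite (eq_bigr (fun=> (h ^+ 2)%:E)) => [|i _].
  by rewrite prodEFin prodr_const card_ord.
rewrite /lebesgue_complex /pushforward sideE product_measure1E//.
rewrite -[LHS]/(lebesgue_measure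
    `[(c * (i == 0 :> nat)%:R)%R, (c * (i == 0 :> nat)%:R + h)%R]%classic *
  lebesgue_measure `[0%R, h]%classic)%E !lebesgue_measure_itv/=.
have [->|hN0] := eqVneq h 0; first by rewrite addr0 !lte_fin !ltxx mul0e expr0n.
have hgt0 : 0 < h by rewrite lt_neqAle eq_sym hN0.
by rewrite !lte_fin ltrDl hgt0 -!EFinD -EFinM addrAC subrr add0r subr0 expr2.
Qed.

Lemma sum_first c : (0 < n)%N -> \sum_(i < n) c * (i == 0 :> nat)%:R = c.
Proof.
move=> n0; rewrite (bigD1 (Ordinal n0))//= mulr1 big1 ?addr0// => i.
by rewrite -val_eqE /= => /negbTE ->; rewrite mulr0.
Qed.

Section estimates.
Variables (c c' h : R) (z w : C_n).
Hypotheses (n0 : (0 < n)%N) (c0 : 0 <= c) (c'0 : 0 <= c') (h0 : 0 <= h).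
Hypotheses (zb : box c' h z) (wb : box c h w).

Lemma box_enorm_ge : c ^+ 2 <= enorm w ^+ 2.
Proof.
rewrite enorm_sqrE -[leLHS]sum_first//; apply: ler_sum => i _.
have [] := wb i; rewrite !in_itv/= => /andP[x1 _] _.
move: x1; case: (_ == _) => /=; rewrite ?mulr1 ?mulr0 => x1.
  by rewrite ler_wpDr ?sqr_ge0// ler_sqr ?nnegrE ?(le_trans c0).
by rewrite addr_ge0 ?sqr_ge0.
Qed.

Lemma box_enorm_le : enorm w ^+ 2 <= c ^+ 2 + n%:R * (2 * c * h + 2 * h ^+ 2).
Proof.
rewrite enorm_sqrE -[X in _ <= X + _]sum_first// mulr_natl -[n in _ *+ n]card_ord.
rewrite -sumr_const -big_split/=; apply: ler_sum => i _.
have [] := wb i; rewrite !in_itv/= => /andP[x1 x2] /andP[y1 y2].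
have Y : complex.Im (tnth w i) ^+ 2 <= h ^+ 2 by rewrite ler_sqr ?nnegrE.
have ch : 0 <= c * h by rewrite mulr_ge0.
move: x1 x2; case: (_ == _) => /=; rewrite ?mulr1 ?mulr0 => x1 x2.
  have : complex.Re (tnth w i) ^+ 2 <= (c + h) ^+ 2.
    by rewrite ler_sqr ?nnegrE ?addr_ge0// (le_trans c0).
  lra.
rewrite add0r in x2.
have : complex.Re (tnth w i) ^+ 2 <= h ^+ 2 by rewrite ler_sqr ?nnegrE.
lra.
Qed.

Lemma box_Re_inner_ge : c' * c <= complex.Re (inner z w).
Proof.
rewrite Re_inner -[leLHS]sum_first//; apply: ler_sum => i _.
have [] := wb i; rewrite !in_itv/= => /andP[x1 _] /andP[y1 _].
have [] := zb i; rewrite !in_itv/= => /andP[u1 _] /andP[v1 _].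
apply: ler_wpDr; first exact: mulr_ge0.
move: x1 u1; case: (_ == _) => /=; rewrite ?mulr1 ?mulr0 => x1 u1.
  exact: ler_pM.
exact: mulr_ge0.
Qed.

Lemma box_Im_inner_le :
  `|complex.Im (inner z w)| <= n%:R * (h * (c + c' + h)).
Proof.
rewrite Im_inner mulr_natl -[n in _ *+ n]card_ord -sumr_const.
apply: le_trans (ler_norm_sum _ _ _) _; apply: ler_sum => i _.
have [] := wb i; rewrite !in_itv/= => /andP[x1 x2] /andP[y1 y2].
have [] := zb i; rewrite !in_itv/= => /andP[u1 u2] /andP[v1 v2].
have b0 r : 0 <= r -> 0 <= r * (i == 0 :> nat)%:R :> R by move=> r0; rewrite mulr_ge0.
have b1 r : 0 <= r -> r * (i == 0 :> nat)%:R <= r :> R.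
  by move=> r0; rewrite ler_piMr// lern1 leq_b1.
have ch : 0 <= c * h by rewrite mulr_ge0.
have c'h : 0 <= c' * h by rewrite mulr_ge0.
have x0 : 0 <= complex.Re (tnth w i) by exact: le_trans (b0 _ c0) x1.
have u0 : 0 <= complex.Re (tnth z i) by exact: le_trans (b0 _ c'0) u1.
have := ler_pM v1 x0 v2 (le_trans x2 (lerD (b1 _ c0) (lexx h))).
have := ler_pM u0 y1 (le_trans u2 (lerD (b1 _ c'0) (lexx h))) y2.
have := mulr_ge0 v1 x0; have := mulr_ge0 u0 y1.
by rewrite ler_norml => ? ? ? ?; apply/andP; split; lra.
Qed.

End estimates.

Lemma gaussian_box_le (r : {posnum R}) c h : (0 < n)%N -> 0 <= c -> 0 <= h ->
  (gaussian n r (box c h) <=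
    ((r%:num / pi) ^+ n * expR (- (r%:num * c ^+ 2)) * (h ^+ 2) ^+ n)%:E)%E.
Proof.
move=> n0 c0 h0; rewrite EFinM -(volume_box c)// -integral_cst; last exact: measurable_box.
apply: ge0_le_integral => //.
- exact: measurable_box.
- by move=> w _; rewrite lee_fin gaussian_density_ge0.
- by apply: measurable_funTS; apply/measurable_EFinP; exact: measurable_gaussian_density.
- move=> w wb; rewrite lee_fin /gaussian_density ler_wpM2l//.
    by rewrite exprn_ge0// divr_ge0// pi_ge0.
  by rewrite ler_expR lerN2 ler_wpM2l// (box_enorm_ge n0 c0 wb).
Qed.

Lemma gaussian_box_ge (r : {posnum R}) c h : (0 < n)%N -> 0 <= c -> 0 <= h ->
  (((r%:num / pi) ^+ n *
     expR (- (r%:num * (c ^+ 2 + n%:R * (2 * c * h + 2 * h ^+ 2)))) *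
     (h ^+ 2) ^+ n)%:E <= gaussian n r (box c h))%E.
Proof.
move=> n0 c0 h0; rewrite EFinM -(volume_box c)// -integral_cst; last exact: measurable_box.
have rn0 : 0 <= (r%:num / pi) ^+ n :> R by rewrite exprn_ge0// divr_ge0// pi_ge0.
apply: ge0_le_integral => //.
- exact: measurable_box.
- by move=> w _; rewrite lee_fin mulr_ge0 ?expR_ge0.
- by apply: measurable_funTS; apply/measurable_EFinP; exact: measurable_gaussian_density.
- move=> w wb; rewrite lee_fin /gaussian_density ler_wpM2l//.
  by rewrite ler_expR lerN2 ler_wpM2l// (box_enorm_le n0 c0 h0 wb).
Qed.

End boxes.

(** * The condition on the exponents is necessary *)

Section necessity.
Context {R : realType} (n : nat) (t s : {posnum R}) (p : R).
Hypotheses (n0 : (0 < n)%N) (p1 : 1 <= p).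
Variable k : n.-tuple R[i] -> n.-tuple R[i] -> R[i].
Hypothesis kP : exponential_kernel t k.

Let p0 : 0 < p. Proof. by rewrite (lt_le_trans _ p1). Qed.

Lemma cos1_le (x : R) : `|x| <= 1 -> cos 1 <= cos x.
Proof.
move=> x1; have pi1 : 1 <= pi :> R by rewrite (le_trans _ (pi_ge2 R))// ler1n.
rewrite -(cos_norm x) leNgt ltr_cos ?in_itv/= ?normr_ge0 ?ler01//=.
  by rewrite -leNgt.
exact: le_trans pi1.
Qed.

(** On a pair of small cubes along the same real direction the kernel hardly
    oscillates: the phase t Im <z, w> stays in [-1, 1]. *)
Lemma box_Re_kernel (c c' h : R) (z w : n.-tuple R[i]) :
  0 <= c -> 0 <= c' -> 0 <= h ->
  t%:num * (n%:R * (h * (c + c' + h))) <= 1 ->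
  box c' h z -> box c h w ->
  cos 1 * expR (t%:num * (c' * c)) <= complex.Re (k z w).
Proof.
move=> c0 c'0 h0 small zb wb; apply: le_trans (Re_kernel kP z w).
rewrite mulrC ler_pM ?expR_ge0//; first exact: ltW (cos1_gt0 R).
  by rewrite ler_expR ler_wpM2l// (box_Re_inner_ge n0 c0 c'0 zb wb).
apply: cos1_le; rewrite normrM ger0_norm//; apply: le_trans small.
by rewrite ler_wpM2l// (box_Im_inner_le c0 c'0 h0 zb wb).
Qed.

Lemma box_kernel_bounded (c h : R) (z : n.-tuple R[i]) : 0 <= c -> 0 <= h ->
  exists M : R, forall w, box c h w -> normc (k z w) <= M.
Proof.
move=> c0 h0; exists (expR (t%:num * (enorm z ^+ 2 +
  (c ^+ 2 + n%:R * (2 * c * h + 2 * h ^+ 2))))) => w wb.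
rewrite (normc_kernel kP) ler_expR ler_wpM2l//.
apply: le_trans (lerD (lexx _) (box_enorm_le n0 c0 h0 wb)).
rewrite Re_inner !enorm_sqrE -big_split/=; apply: ler_sum => i _.
set x := complex.Re _; set y := complex.Im _.
set u := complex.Re _; set v := complex.Im _.
by have := sqr_ge0 (x - u); have := sqr_ge0 (y - v);
  have := sqr_ge0 x; have := sqr_ge0 y; have := sqr_ge0 u; have := sqr_ge0 v; nra.
Qed.

Variable C : R.
Hypothesis C0 : 0 <= C.
Hypothesis bC : intop_bound (gaussian n t) k (gaussian n s) p C.

(** [intop_bound_indic] for the cubes at c and c', after division by the p-th
    root of (s / pi)^n h^(2n), which occurs on both sides. *)
Lemma box_test (c c' h : R) : 0 <= c -> 0 <= c' -> 0 < h ->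
  t%:num * (n%:R * (h * (c + c' + h))) <= 1 ->
  cos 1 * expR (t%:num * (c' * c)) *
    ((t%:num / pi) ^+ n *
     expR (- (t%:num * (c ^+ 2 + n%:R * (2 * c * h + 2 * h ^+ 2)))) *
     (h ^+ 2) ^+ n) *
    expR (- (s%:num * (c' ^+ 2 + n%:R * (2 * c' * h + 2 * h ^+ 2))) / p)
  <= C * expR (- (s%:num * c ^+ 2) / p).
Proof.
move=> c0 c'0 h0 small; have h0' := ltW h0.
have gfin (r : {posnum R}) c1 : (gaussian n r (box c1 h) < +oo)%E.
  apply: (@le_lt_trans _ _ 1%E); last exact: ltry.
  rewrite -(gaussianT n r); apply: le_measure; rewrite ?inE//.
  exact: measurable_box.
have gE (r : {posnum R}) c1 : (fine (gaussian n r (box c1 h)))%:E =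
    gaussian n r (box c1 h).
  by rewrite fineK// ge0_fin_numE.
have M0 : 0 <= cos 1 * expR (t%:num * (c' * c)) :> R.
  by rewrite mulr_ge0 ?expR_ge0// ltW// cos1_gt0.
have : ((cos 1 * expR (t%:num * (c' * c)) * fine (gaussian n t (box c h)))%:E *
    gaussian n s (box c' h) `^ p^-1 <= C%:E * gaussian n s (box c h) `^ p^-1)%E.
  exact: (intop_bound_indic p0 M0 (measurable_box c' h) (measurable_box c h)
  (gfin t c) (gfin s c) (fun z => box_kernel_bounded z c0 h0')
  (fun z w => box_Re_kernel c0 c'0 h0' small) bC).
rewrite -(gE s c') -(gE s c) !poweR_EFin -!EFinM lee_fin.
set nuB := fine (gaussian n t _); set muA := fine (gaussian n s (box c' h)).
set muB := fine _ => test.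
set Q := (t%:num / pi) ^+ n * _ * _.
have QnuB : Q <= nuB by rewrite -lee_fin gE; exact: gaussian_box_ge.
pose W : R := (s%:num / pi) ^+ n * (h ^+ 2) ^+ n.
have W0 : 0 < W.
  by rewrite mulr_gt0// exprn_gt0// ?divr_gt0 ?pi_gt0// exprn_gt0.
have Q0 : 0 <= Q.
  by rewrite !mulr_ge0 ?expR_ge0// exprn_ge0 ?divr_ge0 ?pi_ge0// exprn_ge0.
have Wp0 : 0 < W `^ p^-1 by rewrite powR_gt0.
have powWE (y x : R) : y * expR (x / p) * W `^ p^-1 = y * (W * expR x) `^ p^-1.
  by rewrite powRM ?expR_ge0 ?(ltW W0)// -expRM mulrA mulrAC.
rewrite -(ler_pM2r Wp0).
rewrite (powWE _ (- (s%:num * (c' ^+ 2 + n%:R * (2 * c' * h + 2 * h ^+ 2))))).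
rewrite (powWE C (- (s%:num * c ^+ 2))).
apply: le_trans (le_trans test _).
  apply: ler_pM => //.
  - by rewrite mulr_ge0.
  - exact: powR_ge0.
  - by rewrite ler_wpM2l.
  - apply: ge0_ler_powR; rewrite ?invr_ge0 ?nnegrE ?(ltW p0) ?fine_ge0//.
      by rewrite mulr_ge0 ?expR_ge0 ?(ltW W0).
    rewrite -lee_fin gE; apply: le_trans (gaussian_box_ge s n0 c'0 h0').
    by rewrite lee_fin /W mulrAC.
apply: ler_wpM2l => //.
apply: ge0_ler_powR; rewrite ?invr_ge0 ?nnegrE ?(ltW p0) ?fine_ge0//.
  by rewrite mulr_ge0 ?expR_ge0 ?(ltW W0).
rewrite -lee_fin gE; apply: le_trans (gaussian_box_le s n0 c0 h0') _.
by rewrite lee_fin /W mulrAC.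
Qed.

Lemma expR_ge_exprn (x : R) : 0 <= x -> (x / n.+1%:R) ^+ n.+1 <= expR x.
Proof.
move=> x0; rewrite -[X in expR X](divfK (_ : n.+1%:R != 0)) ?pnatr_eq0//.
rewrite expRM_natr; apply: lerXn2r; rewrite ?nnegrE ?divr_ge0 ?expR_ge0//.
by apply: le_trans (expR_ge1Dx _); rewrite lerDr.
Qed.

(** Apply [box_test] with c = j, c' = l j and h = del / j, where
    l = p t / (2 s) makes j^2 (t (l - 1) - (s / p) (l^2 - 1)), the exponent of
    the comparison, largest: its value is then j^2 (s / p) (l - 1)^2.  Unless
    l = 1, the left-hand side then grows like exp (d j^2) j^(-2n). *)
Lemma bound_exponents : p * t%:num = 2 * s%:num.
Proof.
apply/eqP/negPn/negP => pt2s.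
pose l : R := p * t%:num / (2 * s%:num).
have l0 : 0 < l by rewrite divr_gt0 ?mulr_gt0.
have l1 : l != 1.
  apply: contra_neq pt2s => l1.
  by rewrite -[LHS](divfK (_ : 2 * s%:num != 0)) ?gt_eqF ?mulr_gt0// -/l l1 mul1r.
(* small enough for the phase condition, uniformly in j *)
pose del : R := (1 + t%:num * (n%:R * (2 + l)))^-1.
have tn0 : 0 <= t%:num * (n%:R * (2 + l)).
  by rewrite !mulr_ge0// addr_ge0// ltW.
have del0 : 0 < del by rewrite invr_gt0 ltr_pwDl.
have del1 : del <= 1 by rewrite invf_le1 ?lerDl// ltr_pwDl.
have deltn : t%:num * (n%:R * (2 + l)) * del <= 1.
  by rewrite ler_pdivrMr ?mul1r ?lerDr// ltr_pwDl.
pose d : R := s%:num / p * (l - 1) ^+ 2.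
have d0 : 0 < d.
  by rewrite mulr_gt0 ?divr_gt0// exprn_even_gt0//= subr_eq0.
(* K collects the errors caused by the size of the cubes *)
pose K : R := 4 * n%:R * t%:num + s%:num / p * (n%:R * (2 * l + 2)).
pose c3 : R := cos 1 * (t%:num / pi) ^+ n * expR (- K) * (del ^+ 2) ^+ n *
  (d / n.+1%:R) ^+ n.+1.
have c30 : 0 < c3.
  by rewrite !mulr_gt0 ?expR_gt0 ?cos1_gt0// exprn_gt0// ?exprn_gt0// divr_gt0// pi_gt0.
suff key (j : nat) : (0 < j)%N -> c3 * j%:R ^+ 2 <= C.
  pose j := (Num.truncn (C / c3)).+1.
  have Cj : C < j%:R * c3 by rewrite -ltr_pdivrMr// truncnS_gt.
  have j1 : 1 <= j%:R :> R by rewrite ler1n.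
  have := key j isT; rewrite leNgt => /negP; apply.
  by rewrite (lt_le_trans Cj)// mulrC ler_pM2l// ler_eXnr.
move=> j0; have j0' : 0 < j%:R :> R by rewrite ltr0n.
have j1 : 1 <= j%:R :> R by rewrite ler1n.
pose h : R := del / j%:R.
have h0 : 0 < h by rewrite divr_gt0.
have hj : j%:R * h = del by rewrite mulrC divfK// gt_eqF.
have hdel : h <= del by rewrite ler_pdivrMr// ler_peMr// ltW.
have h2 : h ^+ 2 <= del.
  by rewrite expr2 (le_trans _ hdel)// ler_piMr ?(ltW h0)// (le_trans hdel).
have small : t%:num * (n%:R * (h * (j%:R + l * j%:R + h))) <= 1.
  have hE : h * (j%:R + l * j%:R + h) <= (2 + l) * del.
    have -> : h * (j%:R + l * j%:R + h) = (1 + l) * (j%:R * h) + h ^+ 2 by ring.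
    by rewrite hj; lra.
  apply: le_trans deltn; rewrite -[leRHS]mulrA -[X in _ <= _ * X]mulrA.
  by rewrite ler_wpM2l// ler_wpM2l.
have := @box_test j%:R (l * j%:R) h (ltW j0') (mulr_ge0 (ltW l0) (ltW j0')) h0 small.
pose Q : R := (t%:num / pi) ^+ n; rewrite -/Q => test.
have Q0 : 0 <= Q by rewrite exprn_ge0// divr_ge0// pi_ge0.
have cQh0 : 0 <= cos 1 * Q * (h ^+ 2) ^+ n.
  by rewrite mulr_ge0 ?mulr_ge0 ?(ltW (cos1_gt0 R))// exprn_ge0// sqr_ge0.
pose x : R := j%:R ^+ 2.
have bound : cos 1 * Q * (h ^+ 2) ^+ n * expR (d * x - K) <= C.
  rewrite -(ler_pM2r (expR_gt0 (- (s%:num * j%:R ^+ 2) / p))).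
  apply: le_trans test; rewrite -[leLHS]mulrA -expRD.
  rewrite [leRHS](_ : _ = cos 1 * Q * (h ^+ 2) ^+ n * expR (
    t%:num * (l * j%:R * j%:R) +
    - (t%:num * (j%:R ^+ 2 + n%:R * (2 * j%:R * h + 2 * h ^+ 2))) +
    - (s%:num * ((l * j%:R) ^+ 2 + n%:R * (2 * (l * j%:R) * h + 2 * h ^+ 2))) / p));
    last by rewrite !expRD; ring.
  apply: ler_wpM2l => //.
  rewrite ler_expR.
  (* the quadratic terms agree, because t = 2 l s / p *)
  have tE : t%:num = 2 * l * (s%:num / p).
    by rewrite /l; field; rewrite !gt_eqF.
  have e1 : t%:num * (n%:R * (2 * (j%:R * h) + 2 * h ^+ 2)) <= t%:num * (n%:R * 4).
    by rewrite ler_wpM2l// ler_wpM2l// hj; lra.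
  have e2 : s%:num / p * (n%:R * (2 * l * (j%:R * h) + 2 * h ^+ 2)) <=
      s%:num / p * (n%:R * (2 * l + 2)).
    rewrite ler_wpM2l ?divr_ge0 ?(ltW p0)// ler_wpM2l// hj lerD//.
      by rewrite ler_piMr// mulr_ge0// ltW.
    by rewrite ler_piMr// (le_trans h2).
  have -> : d * x - K + - (s%:num * j%:R ^+ 2) / p =
      t%:num * (l * x) - t%:num * x - s%:num / p * (l ^+ 2 * x)
      - t%:num * (n%:R * 4) - s%:num / p * (n%:R * (2 * l + 2)).
    have e3 : - (s%:num * j%:R ^+ 2) / p = - (s%:num / p * x).
      by rewrite mulNr mulrAC.
    have e4 y : t%:num * y = 2 * l * (s%:num / p) * y by rewrite -tE.
    by rewrite e3 (e4 (l * x)) (e4 x) /K /d; ring.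
  have -> : t%:num * (l * j%:R * j%:R) +
    - (t%:num * (j%:R ^+ 2 + n%:R * (2 * j%:R * h + 2 * h ^+ 2))) +
    - (s%:num * ((l * j%:R) ^+ 2 + n%:R * (2 * (l * j%:R) * h + 2 * h ^+ 2))) / p
    = t%:num * (l * x) - t%:num * x - s%:num / p * (l ^+ 2 * x)
      - t%:num * (n%:R * (2 * (j%:R * h) + 2 * h ^+ 2)) -
      s%:num / p * (n%:R * (2 * l * (j%:R * h) + 2 * h ^+ 2)).
    by rewrite /x; field; rewrite gt_eqF.
  by rewrite lerB// lerB.
apply: le_trans bound.
have -> : c3 * j%:R ^+ 2 = cos 1 * Q * (h ^+ 2) ^+ n *
    (((d * x) / n.+1%:R) ^+ n.+1 * expR (- K)).
  have -> : d * x / n.+1%:R = d / n.+1%:R * x by rewrite mulrAC.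
  rewrite /c3 -/Q -hj [(j%:R * h) ^+ 2]exprMn -/x [(x * _) ^+ n]exprMn.
  rewrite [(_ * x) ^+ n.+1]exprMn [x ^+ n.+1]exprS.
  by ring.
rewrite expRD ler_wpM2l// ler_wpM2r ?expR_ge0//.
by apply: expR_ge_exprn; rewrite mulr_ge0 ?(ltW d0)// sqr_ge0.
Qed.

End necessity.

(** * The equivalence and the norms *)

Theorem mainTheorem1 (R : realType) (n : nat) (n_ge1 : (1 <= n)%N)
    (t s : {posnum R}) (p : R) (p_ge1 : 1 <= p) :
  let T_bounded :=
    intop_bounded (gaussian n t) (T_kernel t) (gaussian n s) p in
  let S_bounded :=
    intop_bounded (gaussian n t) (S_kernel t) (gaussian n s) p in
  let T_norm := intop_norm (gaussian n t) (T_kernel t) (gaussian n s) p in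
  let S_norm := intop_norm (gaussian n t) (S_kernel t) (gaussian n s) p in
  [/\ T_bounded <-> S_bounded,
      S_bounded <-> p * t%:num = 2 * s%:num &
      p * t%:num = 2 * s%:num ->
        (S_norm <= T_norm)%E /\ T_norm = (2 ^+ n)%:E].
Proof.
have suff_ k : exponential_kernel t k -> p * t%:num = 2 * s%:num ->
    intop_bound (gaussian n t) k (gaussian n s) p (2 ^+ n).
  by move=> kP pt2s f [mf _]; exact: cLnorm_intop_le.
have bounded_iff k : exponential_kernel t k ->
    intop_bounded (gaussian n t) k (gaussian n s) p <-> p * t%:num = 2 * s%:num.
  move=> kP; split=> [[_ [C bC]]|pt2s].
    apply: (@bound_exponents _ _ _ _ _ n_ge1 p_ge1 _ kP (Num.max C 0)).
      by rewrite le_max lexx orbT.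
    move=> f /bC /le_trans; apply; apply: lee_wpmul2r; first exact: Lnorm_ge0.
    by rewrite lee_fin le_max lexx.
  split; last by exists (2 ^+ n); exact: suff_.
  by move=> f [mf foo]; exact: (cintegrable_kernel_ae p_ge1 pt2s kP mf foo).
have SP := exponential_S_kernel n t; have TP := exponential_T_kernel n t.
move=> T_bounded S_bounded T_norm S_norm; split.
- by rewrite /T_bounded /S_bounded (bounded_iff _ SP) (bounded_iff _ TP).
- exact: bounded_iff.
move=> pt2s.
have -> : T_norm = (2 ^+ n)%:E.
  apply/eqP; rewrite eq_le; apply/andP; split.
    by apply: ereal_inf_lbound; exists (2 ^+ n) => //; exact: suff_.
  apply: le_ereal_inf_tmp => _ [C bC <-]; rewrite lee_fin.
  exact: T_bound_ge2n bC.
by split=> //; apply: ereal_inf_lbound; exists (2 ^+ n) => //; exact: suff_.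
Qed.
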